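(* The Transversal Independent Set in Even-Hole-Free Graphs problem is FPT.
   Context: Transversal Independent Set in Even-Hole-Free Graphs (TISEHF): input an even-hole-free graph $G$ (a graph with no induced chordless cycle of even length at least four) together with a partition of $V(G)$ into cliques $X_1,\dots,X_k$, parameter $k$; output an independent set of size $k$ if $\alpha(G)\ge k$ (such a set necessarily meets every clique $X_i$ in exactly one vertex) and false otherwise. Here $\alpha(G)$ is the maximum size of an independent set of $G$, and FPT means solvable in time $O(f(k)n^c)$ for some function $f$ and constant $c$. *)

(* Defs.v *)
From mathcomp Require Import all_boot.

Set Implicit Arguments.
Unset Strict Implicit.
Unset Printing Implicit Defensive.

(* Random access machine with the uniform cost measure and the arithmetic of  *)
(* Flum and Grohe (addition, truncated subtraction, halving). Multiplication  *)
(* is left out: with it, the uniform cost would not be polynomially related   *)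
(* to Turing machine time. Registers are named by constants of the program;   *)
(* the memory, which holds the input, is only addressed through registers.    *)

Inductive instr :=
| IConst of nat & nat          (* IConst r c   : R_r := c             *)
| IMove of nat & nat           (* IMove r a    : R_r := R_a           *)
| IAdd of nat & nat & nat      (* IAdd r a b   : R_r := R_a + R_b     *)
| ISub of nat & nat & nat      (* ISub r a b   : R_r := R_a - R_b     *)
| IHalf of nat & nat           (* IHalf r a    : R_r := R_a / 2       *)
| ILoad of nat & nat           (* ILoad r a    : R_r := M[R_a]        *)
| IStore of nat & nat          (* IStore a b   : M[R_a] := R_b        *)
| IJump of nat                 (* IJump l      : goto l               *)
| IJumpZ of nat & nat.         (* IJumpZ a l   : if R_a = 0 goto l    *)

Definition program := seq instr.

Record config := Config {
  pc : nat;
  reg : nat -> nat;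
  mem : nat -> nat
}.

Definition update (f : nat -> nat) (a v : nat) : nat -> nat :=
  fun x => if x == a then v else f x.

Definition set_reg (s : config) (r v : nat) : config :=
  Config (pc s).+1 (update (reg s) r v) (mem s).

Definition exec (i : instr) (s : config) : config :=
  let R := reg s in
  match i with
  | IConst r c => set_reg s r c
  | IMove r a => set_reg s r (R a)
  | IAdd r a b => set_reg s r (R a + R b)
  | ISub r a b => set_reg s r (R a - R b)
  | IHalf r a => set_reg s r (R a)./2
  | ILoad r a => set_reg s r (mem s (R a))
  | IStore a b => Config (pc s).+1 R (update (mem s) (R a) (R b))
  | IJump l => Config l R (mem s)
  | IJumpZ a l => Config (if R a == 0 then l else (pc s).+1) R (mem s)
  end.

(* The machine has halted once the program counter is outside the program;    *)
(* a halted configuration is a fixed point of step.                           *)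
Definition halted (p : program) (s : config) : bool := size p <= pc s.

Definition step (p : program) (s : config) : config :=
  if onth p (pc s) is Some i then exec i s else s.

Definition initial (input : seq nat) : config :=
  Config 0 (fun=> 0) (nth 0 input).

(* R_0 holds the length of the output, which is stored from address 0 on.     *)
Definition output (s : config) : seq nat := mkseq (mem s) (reg s 0).

Definition runs_in (p : program) (input : seq nat) (t : nat) (out : seq nat) :=
  let s := iter t (step p) (initial input) in halted p s /\ output s = out.

Record param_problem := ParamProblem {
  instance : Type;
  encoding : instance -> seq nat;
  isize : instance -> nat;
  param : instance -> nat;
  solution : instance -> seq nat -> Prop
}.

(* A single program for all values of the parameter. Instances of size 0, for *)
(* which n ^ c would vanish, must be solved but are exempt from the bound.    *)
Definition FPT (P : param_problem) : Prop :=
  exists (p : program) (f : nat -> nat) (c C : nat),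
  forall x : instance P, exists (t : nat) (out : seq nat),
    [/\ runs_in p (encoding x) t out,
        solution x out
      & 0 < isize x -> t <= C * (f (param x) * isize x ^ c)].

Section Graphs.

Variables (V : finType) (e : rel V).

Definition independent (S : {set V}) : bool :=
  [forall u in S, forall v in S, ~~ e u v].

Definition clique (S : {set V}) : bool :=
  [forall u in S, forall v in S, (u != v) ==> e u v].

Definition alpha : nat := \max_(S : {set V} | independent S) #|S|.

(* h enumerates the vertices of an induced cycle of length l; ordS is the     *)
(* successor modulo l.                                                        *)
Definition chordless_cycle (l : nat) (h : 'I_l -> V) : Prop :=
  injective h /\
  forall i j : 'I_l, e (h i) (h j) = (j == ordS i) || (i == ordS j).

Definition even_hole_free : Prop :=
  forall (l : nat) (h : 'I_l -> V), 4 <= l -> ~~ odd l -> ~ chordless_cycle h.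

End Graphs.

Record tisehf_instance := TisehfInstance {
  nvert : nat;
  nclq : nat;
  adj : rel 'I_nvert;
  adj_sym : symmetric adj;
  adj_irr : irreflexive adj;
  adj_ehf : even_hole_free adj;
  clq : 'I_nclq -> {set 'I_nvert};
  clq_inj : injective clq;
  clq_partition : partition [set clq i | i : 'I_nclq] [set: 'I_nvert];
  clq_clique : forall i, clique adj (clq i)
}.

(* n, k, the adjacency matrix in row-major order, then the characteristic     *)
(* vectors of the k cliques.                                                  *)
Definition tisehf_encoding (I : tisehf_instance) : seq nat :=
  [:: nvert I; nclq I]
  ++ [seq nat_of_bool (adj u v) | u <- enum 'I_(nvert I), v <- enum 'I_(nvert I)]
  ++ [seq nat_of_bool (v \in clq i)
        | i <- enum 'I_(nclq I), v <- enum 'I_(nvert I)].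

(* The answer false is output as [:: 0]; an independent set is output as 1    *)
(* followed by its vertices, in any order and without repetition.             *)
Definition tisehf_solution (I : tisehf_instance) (out : seq nat) : Prop :=
  if nclq I <= alpha (@adj I) then
    exists s : seq 'I_(nvert I),
      [/\ uniq s, size s = nclq I, independent (@adj I) [set v in s]
        & out = 1 :: [seq val v | v <- s]]
  else out = [:: 0].

Definition TISEHF : param_problem :=
  ParamProblem tisehf_encoding nvert nclq tisehf_solution.

(* Main.v *)
Require Import Defs.
From Stdlib Require Import Classical.
From mathcomp Require Import all_boot zify.

(** Fix an independent transversal [y] of the cliques [X i]. Between two cliques
    of a graph without induced 4-cycle, neighbourhoods are nested. The algorithm
    keeps a set [S] of surviving vertices and repeats the following operation:
    take the vertex [z] of [S :&: X j] with the fewest (or the most) neighbours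
    in [S :&: X l], guess for every clique [i] whether [z] is adjacent to [y i],
    and keep in [X i] only the vertices that agree with the guess. A word of
    length [k ^ 2 * (2 * k + 4) + k] guesses everything, so there are boundedly
    many words, and it is enough to test whether some word leaves an independent
    set of size [k].

    Completeness: let [h] be the graph on the indices of the cliques in which
    [i] and [j] are joined when some edge of [S] links [X i] and [X j]. If [h]
    has an edge, then [2 * k + 4] operations, with the guesses made according to
    some transversal, can destroy one. Suppose not. A probe [z] of [X r] is then
    complete or anticomplete to the survivors of each clique; probing with
    minimal degree yields probes [z], [z'] of [X r] and neighbours [i], [i'] of
    [r] that [z], [z'] distinguish in opposite ways, and absence of induced
    4-cycles makes [i], [i'] nonadjacent in [h]. An induced path of [h] from [i]
    to [i'] avoiding the neighbourhood of [r] would lift, with one or two probes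
    at each of two vertices to adjust the parity, to an even hole of the graph.
    Hence removing the neighbourhood of [r] separates [i] from [i']; choosing
    the separated part minimal gives adjacent [r], [i] such that every neighbour
    of [i] is equal or adjacent to [r]. But in a triangle of [h] a probe at one
    vertex cannot distinguish the other two, so a probe of [X i] of minimal
    degree towards [X r] sees no clique at all: it can replace [y i], which
    isolates [i] in [h]. *)

Set Implicit Arguments.
Unset Strict Implicit.
Unset Printing Implicit Defensive.

(** * Induced paths and holes *)

Section InducedPaths.

Variables (T : finType) (e : rel T).
Hypotheses (e_sym : symmetric e) (e_irr : irreflexive e).

(** Induced paths as lists. Each vertex is compared with later ones only; symmetry of [e] takes care
    of the others in [ipath_nth]. *)
Fixpoint ipath (s : seq T) : bool :=
  if s is x :: s' then
    [&& x \notin s', ~~ has (e x) (behead s'), if s' is w :: _ then e x w else true &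
      ipath s']
  else true.

Lemma ipath_uniq s : ipath s -> uniq s.
Proof. by elim: s => //= x s IHs /and4P[-> _ _ /IHs]. Qed.

Lemma ipath_nth x0 s i j : ipath s -> i < size s -> j < size s ->
  e (nth x0 s i) (nth x0 s j) = (j == i.+1) || (i == j.+1).
Proof.
suff half: forall i j, ipath s -> i < j -> j < size s ->
    e (nth x0 s i) (nth x0 s j) = (j == i.+1).
  move=> s_path lt_i lt_j; case: (ltngtP i j) => [lt_ij|lt_ji|->].
  - by rewrite half //; lia.
  - by rewrite e_sym half //; lia.
  - by rewrite e_irr; lia.
elim: s {i j} => //= x s IHs [|i] [|j] // /and4P[_ nadj adj s_path] lt_ij lt_j.
- case: s nadj adj lt_j {IHs s_path} => // w s /= nadj adj.
  case: j {lt_ij} => [|j] //= lt_j; apply: contraNF nadj => exj.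
  by apply/hasP; exists (nth x0 s j); rewrite ?mem_nth.
- by rewrite /= IHs.
Qed.

Lemma ipath_cons2 x y s : ipath [:: x, y & s] =
  [&& x \notin y :: s, ~~ has (e x) s, e x y & ipath (y :: s)].
Proof. by []. Qed.

Lemma ipath_rcons s x z :
  ipath (rcons s x) -> z \notin s -> ~~ has (e z) s -> e z x ->
  ipath (rcons (rcons s x) z).
Proof.
elim: s => [|y s IHs].
  move=> _ _ _ ezx; rewrite /= e_sym ezx !andbT inE.
  by apply: contraTneq ezx => ->; rewrite e_irr.
move=> s_path; rewrite inE negb_or => /andP[zNy zNs].
rewrite [has _ _]/= negb_or => /andP[nezy nezs] ezx.
have s'_path : ipath (rcons s x) by case/and4P: s_path.
have := IHs s'_path zNs nezs ezx.
case: s s_path {IHs zNs nezs s'_path} => [|w s]; rewrite !rcons_cons !ipath_cons2.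
  case/and4P=> yNx _ eyx _ ->; rewrite /= !inE in yNx *.
  by rewrite eyx negb_or yNx eq_sym zNy e_sym (negbTE nezy).
case/and4P=> yN neys eyw _ ->; rewrite eyw !andbT.
rewrite !inE !mem_rcons !inE !has_rcons in yN neys *.
rewrite !negb_or in yN neys *; rewrite [y == z]eq_sym [e y z]e_sym zNy nezy.
case/and3P: yN => yw yx ys; case/andP: neys => nx ns.
by rewrite yw mem_rcons inE negb_or yx ys nx ns.
Qed.

(* A path and a vertex seeing exactly its two ends close up to a hole of
   length [size m + 3]. *)
Lemma even_hole_free_ipath z a m b :
  even_hole_free e -> ipath (a :: rcons m b) ->
  z \notin m -> ~~ has (e z) m -> e z a -> e z b -> ~~ odd (size m).
Proof.
move=> ehf s_path zNm nezm eza ezb; apply/negP => odd_m.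
pose s := a :: rcons m b; pose L := (size m).+3.
have size_s : size s = (size m).+2 by rewrite /= size_rcons.
have zNs : z \notin s.
  rewrite inE mem_rcons inE !negb_or zNm andbT.
  by apply/andP; split; [apply: contraTneq eza | apply: contraTneq ezb] => ->;
    rewrite e_irr.
have ez i : i < size s -> e z (nth z s i) = (i == 0) || (i == (size m).+1).
  rewrite size_s; case: i => [|i]; rewrite ?eza // [nth _ _ _]/= nth_rcons => lt_i.
  rewrite orFb eqSS; have [lt_im|ge_im] := ltnP i (size m).
    rewrite ltn_eqF //; apply: contraNF nezm => ezi.
    by apply/hasP; exists (nth z m i); rewrite ?mem_nth.
  have -> : i = size m by lia.
  by rewrite eqxx ezb.
pose h (i : 'I_L) := nth z (z :: s) i.
have lt_s (i : 'I_L) : i < size (z :: s) by rewrite /= size_rcons.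
(* The length [size m + 3] is even, and at least 4 because [m], of odd size, is nonempty. *)
apply: (ehf L h); first by rewrite /L; case: m odd_m {zNm nezm s_path s L size_s zNs
  ez h lt_s}.
  by rewrite /L /= odd_m.
have uniq_zs : uniq (z :: s) by rewrite cons_uniq zNs; exact: ipath_uniq.
split=> [i j /eqP|i j]; first by rewrite nth_uniq // => /eqP/val_inj.
have valS (i' : 'I_L) : val (ordS i') = if i' == L.-1 :> nat then 0 else i'.+1.
  rewrite /=; have := ltn_ord i'; case: eqP => [-> _|ne lt_i]; first exact: modnn.
  by rewrite modn_small //; lia.
rewrite -[j == _]val_eqE -[i == _]val_eqE !valS /h.
have [lt_i lt_j] := (lt_s i, lt_s j).
have Ls : size s = L.-1 by rewrite size_s.
(* Index 0 is the apex [z], governed by [ez]; positive indices are positions on the path. *)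
case: {h} i lt_i => -[|i] ltiL /= lt_i; case: j lt_j => -[|j] ltjL /= lt_j.
- by rewrite e_irr.
- by rewrite -/s ez ?Ls //; case: ifP => jL; rewrite /L /= in jL ltjL *; lia.
- by rewrite e_sym -/s ez ?Ls //; case: ifP => jL; rewrite /L /= in jL ltiL *; lia.
- by rewrite -/s ipath_nth ?Ls //; do 2 case: ifP; rewrite /L /= in ltiL ltjL *; lia.
Qed.

(** Otherwise the path [b], [c], [d] closed by [a] is a hole of length 4. *)
Lemma C4_free a b c d : even_hole_free e ->
  e a b -> e b c -> e c d -> e d a -> a != c -> b != d -> e a c || e b d.
Proof.
move=> ehf eab ebc ecd eda ac bd; apply/norP=> -[nac nbd].
have := @even_hole_free_ipath a b [:: c] d ehf; rewrite /= !inE.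
rewrite ebc ecd (negbTE nac) (negbTE nbd) (negbTE bd) (negbTE ac) eab e_sym eda.
have -> : b == c = false by apply: contraTF ebc => /eqP->; rewrite e_irr.
have -> : c == d = false by apply: contraTF ecd => /eqP->; rewrite e_irr.
by move=> /(_ isT isT isT isT isT).
Qed.

(** Jump from [x] to the last vertex of [s] that it equals or sees: no chord is left beyond it. *)
Lemma ipath_extend x s : ipath s -> (x \in s) || has (e x) s ->
  exists q, [/\ ipath (x :: q), {subset q <= s} & last x q = last x s].
Proof.
elim: s => // w s IHs s_path adj_x.
have [adj_s|] := boolP ((x \in s) || has (e x) s).
  have s'_path : ipath s by case/and4P: s_path.
  have [q [q_path sub_q last_q]] := IHs s'_path adj_s.
  exists q; split=> // [v /sub_q|]; first by rewrite inE orbC => ->.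
  by rewrite last_q; case: s adj_s {IHs s_path adj_x s'_path q_path sub_q last_q}.
rewrite negb_or => /andP[xNs nexs]; have [xw|xNw] := eqVneq x w.
  exists s; rewrite xw /=; split=> // v; by rewrite inE orbC => ->.
exists (w :: s); split=> //; rewrite ipath_cons2 inE negb_or xNw xNs nexs s_path.
by move: adj_x; rewrite /= inE (negbTE xNw) (negbTE xNs) (negbTE nexs) /= orbF => ->.
Qed.

Lemma ipath_of_path (A : pred T) x p : path e x p -> all A p ->
  exists q, [/\ ipath (x :: q), all A q & last x q = last x p].
Proof.
elim: p x => [|y p IHp] x /=; first by exists [::].
case/andP=> exy /IHp{IHp}IHp /andP[Ay /IHp[q [q_path Aq last_q]]].
have [|r [r_path sub_r last_r]] := @ipath_extend x (y :: q) q_path.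
  by rewrite /= exy orbT.
exists r; split=> //; last by rewrite last_r -last_q.
by apply/allP=> v /sub_r; rewrite inE => /predU1P[-> //|]; apply/allP.
Qed.

End InducedPaths.

(** * Pockets left by a neighbourhood, and dominated vertices *)

Section Domination.

Variables (T : finType) (h : rel T).
Hypotheses (h_sym : symmetric h) (h_irr : irreflexive h).

Definition off_nbhd (r x : T) : bool := (x != r) && ~~ h r x.

Definition pocket_rel (r i : T) : rel T :=
  [rel a b | [&& (a == i) || off_nbhd r a, (b == i) || off_nbhd r b & h a b]].

(** The component of [i] once [r] and all its neighbours except [i] are deleted. *)
Definition pocket (r i : T) : {set T} := [set x | connect (pocket_rel r i) i x].

Lemma pocket_rel_sym r i : symmetric (pocket_rel r i).
Proof. by move=> a b; rewrite /pocket_rel /= h_sym andbCA. Qed.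

Lemma pocket_out r i x : x \in pocket r i -> (x == i) || off_nbhd r x.
Proof.
rewrite inE => /connectP[p p_path ->]; elim/last_ind: p p_path => [|p y _] /=.
  by rewrite eqxx.
by rewrite rcons_path last_rcons => /andP[_ /and3P[]].
Qed.

Lemma pocket_closed r i x y : x \in pocket r i -> off_nbhd r y -> h x y ->
  y \in pocket r i.
Proof.
move=> x_in out_y hxy; have out_x := pocket_out x_in; rewrite !inE in x_in *.
by apply: connect_trans x_in _; apply: connect1; rewrite /pocket_rel /= out_x out_y
  hxy orbT.
Qed.

Lemma pocket_self r i : i \in pocket r i.
Proof. by rewrite inE connect0. Qed.

(** A common vertex joins a walk from [i] to a walk from [i']; shortcutting keeps the interior out
    of the closed neighbourhood of [r], and the interior is nonempty because the ends are not
    adjacent. *)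
Lemma pocket_meet_ipath r i i' x : i != i' -> ~~ h i i' ->
  x \in pocket r i -> x \in pocket r i' ->
  exists m, [/\ ipath h (i :: rcons m i'), all (off_nbhd r) m & m != [::]].
Proof.
move=> ii' nhii' x_i x_i'.
pose A y := [|| y == i, y == i' | off_nbhd r y].
pose R := [rel a b | [&& h a b & A b]].
have sub_i : subrel (pocket_rel r i) (connect R).
  by move=> a b /= /and3P[_ out_b hab]; apply: connect1; rewrite /= /A hab; case/orP:
    out_b => ->; rewrite ?orbT.
have sub_i' : subrel (pocket_rel r i') (connect R).
  by move=> a b /= /and3P[_ out_b hab]; apply: connect1; rewrite /= /A hab; case/orP:
    out_b => ->; rewrite ?orbT.
have: connect R i i'.
  rewrite !inE in x_i x_i'; apply: connect_trans (connect_sub sub_i x_i) _.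
  by apply: (connect_sub sub_i'); rewrite (sym_connect_sym (@pocket_rel_sym r i')).
case/connectP=> p p_path last_p.
have p_h : path h i p by apply: sub_path p_path => a b /andP[].
have p_A : all A p.
  elim: p (i) p_path {p_h last_p} => //= y p IHp z /andP[/andP[_ ->]]; exact: IHp.
have [q [q_path q_A last_q]] := ipath_of_path p_h p_A.
have q_uniq := ipath_uniq q_path.
elim/last_ind: q q_path q_A last_q q_uniq => [|m y _] q_path q_A last_q q_uniq.
  by move: ii'; rewrite last_p -last_q /= eqxx.
rewrite last_rcons -last_p in last_q; subst y; exists m; split=> //.
  apply/allP=> v v_m; have /allP/(_ v) := q_A; rewrite mem_rcons inE v_m orbT => /(_
    isT).
  move: q_uniq; rewrite /= mem_rcons inE rcons_uniq negb_or => /and3P[/andP[_ iNm]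
    i'Nm _].
  by case/or3P=> // /eqP eq_v; move: iNm i'Nm; rewrite -?eq_v v_m.
by apply: contraNneq nhii' => m0; move: q_path; rewrite m0 ipath_cons2 => /and4P[].
Qed.

(* Minimality of the pocket forces it to be a single vertex. *)
Lemma dominated_vertex :
  (exists r l, h r l) ->
  (forall r l, h r l -> exists i i',
     [/\ h r i, h r i' & [disjoint pocket r i & pocket r i']]) ->
  exists r i, h r i /\ forall a, h i a -> (a == r) || h r a.
Proof.
move=> [r0 [l0 hrl0]] pairs.
(* Arcs whose pocket is disjoint from that of another neighbour of [r]; one with the smallest pocket
   is taken. *)
pose P (ri : T * T) := h ri.1 ri.2 && [exists i', h ri.1 i' && [disjoint pocket ri.1
  ri.2 & pocket ri.1 i']].
have [i0 [i0' [hi0 hi0' dis0]]] := pairs _ _ hrl0.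
have P0 : P (r0, i0) by rewrite /P /= hi0; apply/existsP; exists i0'; rewrite hi0'.
have [[r i]] := @arg_minnP _ (r0, i0) P (fun ri => #|pocket ri.1 ri.2|) P0.
case/andP=> /= hri _ min_ri.
(* A neighbour of [i] outside the closed neighbourhood of [r] would belong to the pocket. *)
suff K1 : forall v, v \in pocket r i -> v = i.
  exists r, i; split=> // a hia; apply: contraTT hri.
  rewrite negb_or => /andP[aNr nhra].
  have a_in : a \in pocket r i by apply: pocket_closed (pocket_self r i) _ hia;
    rewrite /off_nbhd aNr.
  by rewrite (K1 _ a_in) h_irr in hia.
move=> v v_in; apply/eqP/negPn/negP=> vNi.
have /andP[vNr nhrv] : off_nbhd r v by have := pocket_out v_in; rewrite (negbTE vNi).
have [l hvl] : exists l, h v l.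
  move: v_in; rewrite inE => /connectP[p]; elim/last_ind: p => [|p y _] /=.
    by move=> _ vi; rewrite vi eqxx in vNi.
  rewrite rcons_path last_rcons => /andP[_ /and3P[_ _ hly]] ->.
  by exists (last i p); rewrite h_sym.
(* A pocket at [v] avoiding [r] also avoids the neighbours of [r], from which [r] could be reached.
   Being attached to [v], it lies inside the pocket of [i], and it misses [i] itself, so minimality
   excludes it. *)
have small a : h v a -> r \notin pocket v a -> ~~ P (v, a).
  move=> hva rNa; apply/negP=> Pva; have := min_ri _ Pva; apply/negP; rewrite -ltnNge
    /=.
  have nhr x : x \in pocket v a -> off_nbhd r x.
    move=> x_in; apply/andP; split; first by apply: contraNneq rNa => <-.
    apply: contra rNa => hrx; apply: pocket_closed x_in _ _; last by rewrite h_sym.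
    by rewrite /off_nbhd eq_sym vNr h_sym nhrv.
  apply: proper_card; apply/properP; split; last first.
    by exists i; [exact: pocket_self | apply/negP=> /nhr; rewrite /off_nbhd hri andbF].
  apply/subsetP=> x; rewrite inE => /connectP[p p_path ->].
  elim/last_ind: p p_path => [|p y IHp] /=.
    by move=> _; apply: pocket_closed v_in (nhr _ (pocket_self v a)) hva.
  rewrite rcons_path last_rcons => /andP[p_path ey].
  apply: pocket_closed (IHp p_path) _ _; last by case/and3P: ey.
  apply: nhr; rewrite inE; apply/connectP; exists (rcons p y); last by rewrite
    last_rcons.
  by rewrite rcons_path p_path.
(* Of two disjoint pockets at [v], at least one avoids [r]. *)
have [a [a' [hva hva' dis]]] := pairs _ _ hvl.
have [r_a|rNa] := boolP (r \in pocket v a); last first.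
  by have := small _ hva rNa; rewrite /P /= hva; case/existsP; exists a'; rewrite
    hva' dis.
have rNa' : r \notin pocket v a' by apply: contraTN dis => r_a'; apply/pred0Pn;
  exists r; rewrite /= r_a.
have := small _ hva' rNa'; rewrite /P /= hva'; case/existsP; exists a.
by rewrite hva disjoint_sym.
Qed.

End Domination.

(** * The search on cliques *)

Section Search.

Variables (V : finType) (e : rel V).
Hypotheses (e_sym : symmetric e) (e_irr : irreflexive e).
Hypothesis e_ehf : even_hole_free e.
Variables (k : nat) (X : 'I_k -> {set V}).
Hypothesis X_clique : forall i u v, u \in X i -> v \in X i -> u != v -> e u v.
Hypothesis X_disj : forall i j u, u \in X i -> u \in X j -> i = j.

Implicit Types (S : {set V}) (r i j l : 'I_k) (u v z : V).

Definition degree (S : {set V}) (l : 'I_k) (v : V) : nat :=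
  #|[set w in S | (w \in X l) && e v w]|.

(** The choice is abstract so that the vertex found by the program, with its own way of breaking
    ties, can be substituted. *)
Variable pick : {set V} -> 'I_k -> 'I_k -> bool -> V.
Hypothesis pickP : forall (S : {set V}) j l x v, v \in S -> v \in X j ->
  [/\ pick S j l x \in S, pick S j l x \in X j
    & if x then degree S l v <= degree S l (pick S j l x)
      else degree S l (pick S j l x) <= degree S l v].

Definition op : Type := 'I_k * 'I_k * bool * {ffun 'I_k -> bool}.

(** By irreflexivity the guess at [j] itself has a special meaning: false leaves only the picked
    vertex in [X j], true removes just that vertex. *)
Definition keep (S : {set V}) (o : op) : {set V} :=
  let: (j, l, x, b) := o in
  [set w in S | [forall i, (w \in X i) ==> (e w (pick S j l x) == b i)]].

Definition search : {set V} -> seq op -> {set V} := foldl keep.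

Definition linked (S : {set V}) : rel 'I_k := fun i j =>
  (i != j) && [exists u in S, exists v in S, [&& u \in X i, v \in X j & e u v]].

Definition indep_transversal (S : {set V}) (y : 'I_k -> V) : Prop :=
  (forall i, y i \in S /\ y i \in X i) /\ forall i j, ~~ e (y i) (y j).

Lemma linkedP S i j : reflect
  (i != j /\ exists u v, [/\ u \in S, v \in S, u \in X i, v \in X j & e u v])
  (linked S i j).
Proof.
apply: (iffP andP) => -[ij]; last first.
  move=> [u [v [uS vS ui vj euv]]]; split=> //; apply/existsP; exists u.
  by rewrite uS; apply/existsP; exists v; rewrite vS ui vj.
case/existsP=> u /andP[uS /existsP[v /and4P[vS ui vj euv]]].
by split=> //; exists u, v.
Qed.

Lemma linked_irr S : irreflexive (linked S).
Proof. by move=> i; rewrite /linked eqxx. Qed.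

Lemma linked_sym S : symmetric (linked S).
Proof.
suff imp i j : linked S i j -> linked S j i by move=> i j; apply/idP/idP; apply: imp.
case/linkedP=> ij [u [v [uS vS ui vj euv]]]; apply/linkedP; rewrite eq_sym.
by split=> //; exists v, u; rewrite e_sym.
Qed.

Lemma linked_sub S S' : S' \subset S -> subrel (linked S') (linked S).
Proof.
move=> /subsetP sub i j /linkedP[ij [u [v [uS vS ui vj euv]]]]; apply/linkedP.
by split=> //; exists u, v; split=> //; apply: sub.
Qed.

Lemma keep_sub S o : keep S o \subset S.
Proof. by case: o => -[[j l] x] b; apply/subsetP=> w; rewrite inE => /andP[]. Qed.

Lemma search_sub S w : search S w \subset S.
Proof.
by elim: w S => //= o w IHw S; apply: subset_trans (IHw _) (keep_sub _ _).
Qed.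

Lemma X_neq i j u v : i != j -> u \in X i -> v \in X j -> u != v.
Proof. by move=> ij ui vj; apply: contraNneq ij => uv; apply/eqP/(X_disj ui); rewrite
  uv. Qed.

(* Otherwise [v] has a private neighbour [w'] in [X l], and [u], [w], [w'], [v]
   form an induced 4-cycle. *)
Lemma degree_nested S j l u v w : j != l -> u \in X j -> v \in X j ->
  degree S l u <= degree S l v -> w \in S -> w \in X l -> e u w -> e v w.
Proof.
move=> jl uj vj le_uv wS wl euw; apply/negPn/negP=> nevw.
have uv : u != v by apply: contraNneq nevw => <-.
have [/subsetP sub|/subsetPn[w']] := boolP
    ([set w in S | (w \in X l) && e v w] \subset [set w in S | (w \in X l) && e u w]).
  have /proper_card : [set w in S | (w \in X l) && e v w] \proper [set w in S | (w
    \in X l) && e u w].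
    apply/properP; split; first exact/subsetP.
    by exists w; rewrite inE wS wl //= (negbTE nevw).
  by rewrite ltnNge le_uv.
rewrite !inE => /and3P[w'S w'l evw']; rewrite w'S w'l /= => neuw'.
have ww' : w != w' by apply: contraNneq neuw' => <-.
have := C4_free e_sym e_irr e_ehf euw (X_clique wl w'l ww') _ (X_clique vj uj _).
rewrite eq_sym uv e_sym evw' (negbTE neuw') e_sym (negbTE nevw) => /(_ isT isT).
by rewrite (X_neq jl uj w'l) eq_sym (X_neq jl vj wl) => /(_ isT isT).
Qed.

(** No sequence of at most [c] operations that spares some transversal destroys a link. The empty
    word is included, so [h] is the link graph of [S] itself as soon as [S] has a transversal. *)
Definition rigid (h : rel 'I_k) (c : nat) (S : {set V}) : Prop :=
  forall w, size w <= c -> (exists y, indep_transversal (search S w) y) ->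
  linked (search S w) =2 h.

(** * Probes in a set whose links cannot be destroyed *)

Section Rigid.

Variables (h : rel 'I_k) (y : 'I_k -> V).
Hypotheses (h_sym : symmetric h) (h_irr : irreflexive h).

Definition stuck (c : nat) (S : {set V}) : Prop := indep_transversal S y /\ rigid h c S.

Lemma stuck_le c c' S : c' <= c -> stuck c S -> stuck c' S.
Proof. by move=> le_c [ty rS]; split=> // w /leq_trans/(_ le_c); apply: rS. Qed.

Lemma stuck_edge c S i j u v : stuck c S -> i != j -> u \in S -> v \in S ->
  u \in X i -> v \in X j -> e u v -> h i j.
Proof.
move=> [ty rS] ij uS vS ui vj euv.
rewrite -(rS [::]) //; last by exists y.
by apply/linkedP; split=> //; exists u, v.
Qed.

Lemma stuck_h c S i j : stuck c S -> h i j ->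
  i != j /\ exists u v, [/\ u \in S, v \in S, u \in X i, v \in X j & e u v].
Proof. by move=> [ty rS]; rewrite -(rS [::]) => [/linkedP//||]; last exists y. Qed.

(** [z] is complete or anticomplete to what survives of each clique, and [y i] tells which. *)
Definition pure (S : {set V}) (z : V) : Prop :=
  forall i w, w \in S -> w \in X i -> e z w = e z (y i).

(** The probe may lie outside [S], since its own operation can discard it. *)
Definition probe (S : {set V}) (r : 'I_k) (z : V) : Prop :=
  [/\ z \in X r, pure S z & forall j, j != r -> e z (y j) -> h r j].

Lemma probe_sub S S' r z : S' \subset S -> probe S r z -> probe S' r z.
Proof.
by move=> /subsetP sub [zr pz hz]; split=> // i w wS; apply: pz; apply: sub.
Qed.

Lemma rigid_keep c S o : rigid h c.+1 S -> rigid h c (keep S o).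
Proof. by move=> rS w le_w; apply: (rS (o :: w)). Qed.

(** Guessing the adjacencies of [z] to [y] spares [y] and turns [z] into a probe, at the cost of one
    operation. *)
Lemma pick_probe c S j l x (z := pick S j l x) : stuck c.+1 S ->
  exists S1, [/\ probe S1 j z, S1 \subset S, stuck c S1
    & forall w, w \in S1 -> w \in S /\ forall i, w \in X i -> e w z = e (y i) z].
Proof.
move=> stS; have [[yS indy] rS] := stS.
have [yjS yjj] := yS j; have [zS zj _] := pickP l x yjS yjj.
have yE (i i' : 'I_k) : (y i \in X i') = (i == i').
  by apply/idP/eqP => [/(X_disj (yS i).2)|<-] //; case: (yS i).
pose S1 := keep S (j, l, x, [ffun i => e (y i) z]).
have S1E w : w \in S1 -> w \in S /\ forall i, w \in X i -> e w z = e (y i) z.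
  rewrite inE => /andP[wS /forallP wz]; split=> // i wi.
  by have := wz i; rewrite wi ffunE => /eqP.
exists S1; split=> //; first split=> //.
- by move=> i w /S1E[_ wz] wi; rewrite e_sym (wz _ wi) e_sym.
- move=> i ij ezy; apply: (stuck_edge stS _ zS (yS i).1 zj (yS i).2 ezy).
  by rewrite eq_sym.
- exact: keep_sub.
- split; last exact: rigid_keep.
  split=> // i; split; last by case: (yS i).
  rewrite inE (yS i).1; apply/forallP=> i'; rewrite yE ffunE.
  by apply/implyP=> /eqP->.
Qed.

(** If [z] missed [y l], no survivor of [X l] would see [z]. But the link between [j] and [l]
    persists, and by nestedness a vertex of largest degree sees the end in [X l] of any surviving
    edge. *)
Lemma probe_max c S j l : stuck c.+1 S -> h j l ->
  exists z S1, [/\ probe S1 j z, z \in S, e z (y l), S1 \subset S & stuck c S1].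
Proof.
move=> stS hjl; have [jl _] := stuck_h stS hjl.
have [[yS indy] rS] := stS; have [yjS yjj] := yS j.
have [zS zj _] := pickP l true yjS yjj; set z := pick _ _ _ _ in zS zj.
have [S1 [pz sub stS1 S1E]] := pick_probe j l true stS.
exists z, S1; split=> //; apply/negPn/negP=> nez.
have [_ [u [v [uS1 vS1 uj vl euv]]]] := stuck_h stS1 hjl.
have [uS _] := S1E _ uS1; have [vS /(_ _ vl)] := S1E _ vS1.
rewrite -/z [e (y l) z]e_sym (negbTE nez) e_sym => /negP; case.
have [_ _ max_z] := pickP l true uS uj.
exact: degree_nested jl uj zj max_z vS vl euv.
Qed.

(** By nestedness the neighbours of [z] in [X l] are neighbours of [y j], so [y l] is not among
    them. That [z] sees some other [y i] is where rigidity enters. *)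
Lemma probe_min c S j l : stuck c.+1 S -> h j l ->
  exists z S1, [/\ probe S1 j z, ~~ e z (y l), S1 \subset S, stuck c S1
    & exists2 i, h j i & e z (y i)].
Proof.
move=> stS hjl; have [jl _] := stuck_h stS hjl.
have [[yS indy] rS] := stS; have [yjS yjj] := yS j.
have [zS zj min_z] := pickP l false yjS yjj; set z := pick _ _ _ _ in zS zj min_z.
have [S1 [pz sub stS1 S1E]] := pick_probe j l false stS.
exists z, S1; split=> //.
  apply: contra (indy j l).
  exact: degree_nested jl zj yjj min_z (yS l).1 (yS l).2.
have [/existsP[i /andP[ij ezi]]|/existsPn none] := boolP [exists i, (i != j) && e z
  (y i)].
  by exists i => //; case: pz => _ _; apply.
(* Otherwise replacing [y j] by [z] gives an independent transversal isolating [j]. *)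
have {none}none i : i != j -> ~~ e z (y i).
  by move=> ij; have := none i; rewrite ij.
pose S2 := keep S (j, l, false, [ffun=> false]).
have S2E w : (w \in S2) = (w \in S) && [forall i, (w \in X i) ==> ~~ e w z].
  rewrite inE; congr (_ && _); apply: eq_forallb => i; rewrite ffunE -/z.
  by case: (e w z).
pose y' i := if i == j then z else y i.
have ty' : indep_transversal S2 y'.
  split=> [i|i i']; rewrite /y'.
    case: eqP => [->|/eqP ij]; rewrite S2E ?zS ?(yS i).1; split=> //; try by case:
      (yS i).
      by apply/forallP=> i'; rewrite e_irr implybT.
    by apply/forallP=> i'; rewrite e_sym none // implybT.
  case: eqP => [_|/eqP ij]; case: eqP => [_|/eqP i'j]; rewrite ?e_irr ?none //.
  by rewrite e_sym none.
have := rS [:: (j, l, false, [ffun=> false])] isT (ex_intro _ y' ty') j l.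
rewrite hjl => /linkedP[_ [u [v [uS2 vS2 uj vl euv]]]].
move: uS2 vS2; rewrite /= -/S2 !S2E.
move=> /andP[uS /forallP/(_ j)] + /andP[vS /forallP/(_ l)]; rewrite uj vl /= => neuz
  nevz.
(* [z] is the only vertex of the clique [X j] not adjacent to [z]. *)
have uz : u = z by apply/eqP; apply: contraNT neuz => /(X_clique uj zj).
by rewrite -uz e_sym euv in nevz.
Qed.

Lemma probe_self c S r z i : stuck c S -> probe S r z -> e z (y i) -> e z (y r).
Proof.
move=> [[yS indy] _] [zr _ _] ezi; apply: (X_clique zr (yS r).2).
by apply: contraTneq ezi => ->; rewrite (negbTE (indy r i)).
Qed.

(** An edge [u v] between survivors of [X i] and [X i'] would give the induced 4-cycle [z], [u],
    [v], [z']. *)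
Lemma incomparable_unlinked c S r z z' i i' : stuck c S ->
  probe S r z -> probe S r z' -> i != r -> i' != r ->
  e z (y i) -> ~~ e z (y i') -> e z' (y i') -> ~~ e z' (y i) -> ~~ h i i'.
Proof.
move=> stS [zr pz _] [z'r pz' _] ir i'r ezi nezi' ez'i' nez'i.
apply/negP=> /(stuck_h stS)[_ [u [v [uS vS ui vi' euv]]]].
rewrite -(pz _ _ uS ui) -(pz _ _ vS vi') in ezi nezi'.
rewrite -(pz' _ _ uS ui) -(pz' _ _ vS vi') in ez'i' nez'i.
have z'z : z' != z by apply: contraNneq nezi' => <-.
have := C4_free e_sym e_irr e_ehf ezi euv _ (X_clique z'r zr z'z).
rewrite e_sym ez'i' (negbTE nezi') e_sym (negbTE nez'i) => /(_ isT).
by rewrite eq_sym (X_neq i'r vi' zr) (X_neq ir ui z'r) => /(_ isT isT).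
Qed.

(** If [u] missed [y r], a survivor [v] of [X r] seeing both [y a] and [y i] would form the induced
    4-cycle [y i], [u], [y a], [v]. Hence maximal probes of [X r] towards [a] and towards [i] are
    incomparable, and [a], [i] would not be linked. *)
Lemma triangle_uniform c S u i r a : stuck c.+2 S -> probe S i u ->
  h i r -> h r a -> h i a -> e u (y a) -> e u (y r).
Proof.
move=> stS pu hir hra hia eua; apply/negPn/negP=> neur.
have [[yS indy] _] := stS; have [ui purity _] := pu.
have [ir _] := stuck_h stS hir; have [ia _] := stuck_h stS hia.
have [ra _] := stuck_h stS hra.
have noC4 v : v \in S -> v \in X r -> e v (y a) -> ~~ e v (y i).
  move=> vS vr eva; apply/negP=> evi.
  have yiu : e (y i) u by rewrite e_sym (probe_self stS pu eua).
  have := C4_free e_sym e_irr e_ehf yiu eua _ evi.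
  rewrite e_sym eva (negbTE (indy i a)) (purity _ _ vS vr) (negbTE neur) => /(_ isT).
  by rewrite (X_neq ia (yS i).2 (yS a).2) (X_neq ir ui vr) => /(_ isT isT).
have [v [S1 [pv vS eva sub1 st1]]] := probe_max stS hra.
have hri : h r i by rewrite h_sym.
have [v' [S2 [pv' v'S1 ev'i sub2 st2]]] := probe_max st1 hri.
have v'S : v' \in S by apply: (subsetP sub1).
have [[vr _ _] [v'r _ _]] := (pv, pv').
have nevi := noC4 v vS vr eva.
have nev'a : ~~ e v' (y a) by apply: contraL ev'i => /(noC4 v' v'S v'r).
have := incomparable_unlinked st2 (probe_sub sub2 pv) pv' _ _ eva nevi ev'i nev'a.
by rewrite eq_sym ra ir h_sym hia => /(_ isT isT).
Qed.

Lemma probes_min c S r ls : stuck (size ls + c) S -> all (h r) ls ->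
  exists (Z : 'I_k -> V) S1, [/\ S1 \subset S, stuck c S1 & forall l, l \in ls ->
    [/\ probe S1 r (Z l), ~~ e (Z l) (y l) & exists2 i, h r i & e (Z l) (y i)]].
Proof.
elim: ls S => [|l ls IHls] S stS; first by exists y, S.
case/andP=> hrl all_ls.
have [z [S1 [pz nez sub1 st1 exi]]] := probe_min stS hrl.
have [Z [S2 [sub2 st2 ZP]]] := IHls _ st1 all_ls.
exists (fun i => if i == l then z else Z i), S2; split=> //.
  exact: subset_trans sub2 sub1.
move=> i; rewrite inE; case: eqP => [-> _|_ /ZP //].
by split=> //; apply: probe_sub pz.
Qed.

(** Let [Z l] be a minimal probe towards [l], and let [y i] be seen by as many of these as possible.
    [Z i] misses [y i] but sees some [y i']; by maximality another probe sees [y i] and misses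
    [y i']. *)
Lemma incomparable_pair c S r l : stuck (k + c) S -> h r l ->
  exists i i' z z' S1, [/\ h r i, h r i', S1 \subset S, stuck c S1 &
    [/\ probe S1 r z, probe S1 r z',
      e z (y i) && ~~ e z (y i') & e z' (y i') && ~~ e z' (y i)]].
Proof.
move=> stS hrl; pose ls := enum (h r).
have st' : stuck (size ls + c) S.
  by apply: stuck_le stS; rewrite leq_add2r -cardE -[X in _ <= X]card_ord max_card.
have [|Z [S1 [sub1 st1 ZP]]] := probes_min (r := r) st'.
  by apply/allP=> i; rewrite mem_enum.
have {}ZP i : h r i -> [/\ probe S1 r (Z i), ~~ e (Z i) (y i)
    & exists2 i', h r i' & e (Z i) (y i')].
  by move=> hri; apply: ZP; rewrite mem_enum.
pose N i := [set l | h r l && e (Z l) (y i)].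
have [i hri max_i] := arg_maxnP (fun i => #|N i|) hrl.
have [pZi neZi [i' hri' eZi']] := ZP i hri.
have [|z] := subsetPn (_ : ~~ (N i \subset N i')).
  apply/negP=> sub; have := max_i i' hri'; apply/negP; rewrite -ltnNge.
  apply: proper_card; apply/properP; split=> //.
  by exists i; rewrite !inE hri // (negbTE neZi).
rewrite !inE => /andP[hrz eZz]; rewrite hrz /= => neZz.
have [pZz _ _] := ZP z hrz.
by exists i, i', (Z z), (Z i), S1; split=> //; split=> //; apply/andP.
Qed.

(** * Lifting induced paths of the link graph to holes *)

Definition along (S : {set V}) (c : seq 'I_k) (q : seq V) : bool :=
  all2 (fun i v => (v \in S) && (v \in X i)) c q.

Lemma along_adj S r z c q : probe S r z -> along S c q ->
  map (e z) q = map (fun i => e z (y i)) c.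
Proof.
move=> [_ pz _]; elim: c q => [|i c IHc] [|v q] //= /andP[/andP[vS vi] /IHc->].
by rewrite (pz i).
Qed.

Lemma along_size S c q : along S c q -> size q = size c.
Proof. by rewrite /along all2E => /andP[/eqP]. Qed.

Lemma along_sub S S' c q : S' \subset S -> along S' c q -> along S c q.
Proof.
move=> /subsetP sub; elim: c q => [|i c IHc] [|v q] //=.
by case/andP=> /andP[/sub-> ->] /IHc.
Qed.

Lemma along_notin S c q r z : along S c q -> z \in X r -> r \notin c -> z \notin q.
Proof.
elim: c q => [|i c IHc] [|v q] //= /andP[/andP[_ vi] /IHc{}IHc] zr.
by rewrite !inE !negb_or => /andP[ri /(IHc zr)->]; rewrite (X_neq ri zr vi).
Qed.

Lemma along_nonadj c0 S S' r z c q : stuck c0 S -> S' \subset S -> along S' c q ->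
  z \in S -> z \in X r -> r \notin c -> ~~ has (h r) c -> ~~ has (e z) q.
Proof.
move=> stS sub al zS zr; elim: c q al => [|i c IHc] [|v q] //=.
case/andP=> /andP[vS vi] /IHc{}IHc; rewrite inE !negb_or => /andP[ri rc] /andP[hri hc].
rewrite IHc // andbT; apply: contra hri => ezv.
by apply: (stuck_edge stS ri zS _ zr vi ezv); apply: (subsetP sub).
Qed.

(** Each clique on the path contributes a maximal probe towards the next one. By purity it sees
    whatever survivor is used there, and cliques that are not linked contribute no chords. *)
Lemma chain c S : stuck (size c) S -> ipath h c ->
  exists2 q, ipath e q & along S c q.
Proof.
elim: c S => [|i [|j c] IHc] S stS c_path; first by exists [::].
  by have [[yS _] _] := stS; exists [:: y i] => //=; rewrite (yS i).1 (yS i).2.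
have /and4P[iN nhi hij {}c_path] : [&& i \notin j :: c, ~~ has (h i) c, h i j & ipath
  h (j :: c)] := c_path.
have [z [S1 [pz zS ezj sub1 st1]]] := probe_max stS hij.
have [q q_path al] := IHc _ st1 c_path; have [zi _ _] := pz.
exists (z :: q); last first.
  by apply/andP; split; [rewrite zS zi | exact: along_sub al].
have zq := along_notin al zi iN.
case: q q_path al zq => [|v q] // q_path /andP[/andP[vS1 vj] al] zq.
rewrite ipath_cons2 zq q_path andbT /=; apply/andP; split; last first.
  by case: pz => _ /(_ _ _ vS1 vj)-> _.
by apply: along_nonadj stS sub1 al zS zi _ nhi; move: iN; rewrite inE negb_or =>
  /andP[].
Qed.

Lemma along_rcons S m i mq b :
  along S (rcons m i) (rcons mq b) = along S m mq && ((b \in S) && (b \in X i)).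
Proof.
rewrite /along !all2E !size_rcons eqSS.
by case: eqP => //= sz; rewrite zip_rcons // all_rcons andbC.
Qed.

Lemma along_ends S i m i' q : along S (i :: rcons m i') q ->
  exists a mq b, [/\ q = a :: rcons mq b & along S m mq].
Proof.
case: q => // a q /andP[_]; case/lastP: q => [|q b]; first by case: m.
move=> al; have : along S (rcons m i') (rcons q b) := al.
by rewrite along_rcons => /andP[{}al _]; exists a, q, b.
Qed.

Lemma along_has S r z c q : probe S r z -> along S c q ->
  has (e z) q = has (fun i => e z (y i)) c.
Proof.
move=> pz al; rewrite -[has (e z) q](has_map (e z) id) (along_adj pz al).
by rewrite has_map.
Qed.

Lemma along_last S r z i m i' a mq b : probe S r z ->
  along S (i :: rcons m i') (a :: rcons mq b) ->
  e z a = e z (y i) /\ e z b = e z (y i').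
Proof.
move=> pz /(along_adj pz) /=; rewrite !map_rcons => -[-> eq_m]; split=> //.
by have := congr1 (last true) eq_m; rewrite !last_rcons.
Qed.

Lemma probe_off S r z m : probe S r z -> all (off_nbhd h r) m ->
  ~~ has (fun i => e z (y i)) m.
Proof.
move=> [_ _ hz] /allP off_m; apply/hasPn=> j /off_m /andP[jr nhrj].
by apply: contra nhrj => /(hz j jr).
Qed.

Lemma off_notin r m : all (off_nbhd h r) m -> r \notin m.
Proof. by move=> /allP off_m; apply/negP=> /off_m; rewrite /off_nbhd eqxx. Qed.

Lemma ipath_cons_along S r z i c q : probe S r z -> along S (i :: c) q ->
  ipath e q -> r \notin i :: c -> e z (y i) -> ~~ has (fun j => e z (y j)) c ->
  ipath e (z :: q).
Proof.
move=> pz al q_path rN ezi nezc; have [zr _ _] := pz.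
have zq := along_notin al zr rN.
case: q al q_path zq => // v q /= /andP[/andP[vS vi] al] q_path zq.
rewrite zq q_path andbT (along_has pz al) nezc /=.
by case: pz => _ /(_ _ _ vS vi)-> _.
Qed.

(** One probe of [X r] seeing both ends closes the lifted path to a hole of length [size m + 3]. *)
Lemma close_single S r t i m i' : stuck (size m + 2) S -> probe S r t ->
  ipath h (i :: rcons m i') -> all (off_nbhd h r) m ->
  e t (y i) -> e t (y i') -> ~~ odd (size m).
Proof.
move=> stS pt c_path off_m eti eti'.
have st' : stuck (size (i :: rcons m i')) S by rewrite /= size_rcons -addn2.
have [q q_path al] := chain st' c_path.
have [a [mq [b [q_eq al_m]]]] := along_ends al; rewrite q_eq in q_path al.
have [eta etb] := along_last pt al; have [tr _ _] := pt.
rewrite -(along_size al_m); apply: (even_hole_free_ipath e_sym e_irr e_ehf q_path (z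
  := t)).
- exact: along_notin al_m tr (off_notin off_m).
- by rewrite (along_has pt al_m) (probe_off pt).
- by rewrite eta.
- by rewrite etb.
Qed.

(** Two probes of [X r], each seeing one end, close the lifted path to a hole of length
    [size m + 4]. *)
Lemma close_double S r z z' i m i' : stuck (size m + 2) S ->
  probe S r z -> probe S r z' -> i != r -> i' != r ->
  ipath h (i :: rcons m i') -> all (off_nbhd h r) m ->
  e z (y i) -> ~~ e z (y i') -> e z' (y i') -> ~~ e z' (y i) -> odd (size m).
Proof.
move=> stS pz pz' ir i'r c_path off_m ezi nezi' ez'i' nez'i.
have st' : stuck (size (i :: rcons m i')) S by rewrite /= size_rcons -addn2.
have [q q_path al] := chain st' c_path.
have [a [mq [b [q_eq al_m]]]] := along_ends al; rewrite q_eq in q_path al.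
have [[eza ezb] [ez'a ez'b]] := (along_last pz al, along_last pz' al).
have [[zr _ _] [z'r _ _]] := (pz, pz').
have zz' : z' != z by apply: contraNneq nezi' => <-.
have rN : r \notin i :: rcons m i'.
  by rewrite inE mem_rcons inE !negb_or (off_notin off_m) ![r == _]eq_sym ir i'r.
have zq : z \notin a :: rcons mq b := along_notin al zr rN.
have z'q : z' \notin a :: rcons mq b := along_notin al z'r rN.
have zq_path : ipath e (z :: rcons (a :: mq) b).
  rewrite rcons_cons ipath_cons2 zq eza ezi q_path has_rcons ezb (negbTE nezi').
  by rewrite (along_has pz al_m) (probe_off pz).
have -> : odd (size m) = ~~ odd (size (a :: mq)) by rewrite /= negbK (along_size al_m).
apply: (even_hole_free_ipath e_sym e_irr e_ehf zq_path (z := z')) => /=.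
- by apply: contra z'q; rewrite !inE mem_rcons inE => /orP[->|->]; rewrite ?orbT.
- by rewrite ez'a (negbTE nez'i) (along_has pz' al_m) (probe_off pz').
- by apply: X_clique z'r zr zz'.
- by rewrite ez'b.
Qed.

(** Take maximal probes towards [i] and [i']: either one sees both targets, or they are
    incomparable. *)
Lemma single_or_double c S r i i' : stuck c.+2 S -> h r i -> h r i' ->
  exists S1, [/\ S1 \subset S, stuck c S1 &
    (exists t, [/\ probe S1 r t, t \in S, e t (y i) & e t (y i')]) \/
    (exists t t', [/\ probe S1 r t, probe S1 r t', (t \in S) && (t' \in S),
        e t (y i) && ~~ e t (y i') & e t' (y i') && ~~ e t' (y i)])].
Proof.
move=> stS hri hri'.
have [t [S1 [pt tS eti sub1 st1]]] := probe_max stS hri.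
have [t' [S2 [pt' t'S1 et'i' sub2 st2]]] := probe_max st1 hri'.
have t'S := subsetP sub1 _ t'S1.
exists S2; split=> //; first exact: subset_trans sub2 sub1.
have {}pt := probe_sub sub2 pt.
have [eti'|neti'] := boolP (e t (y i')); first by left; exists t.
have [et'i|net'i] := boolP (e t' (y i)); first by left; exists t'.
by right; exists t, t'; rewrite tS t'S eti et'i' neti' net'i.
Qed.

(** [r] and the path form a cycle of the link graph. Doubling the probe at [r] fixes its parity; the
    choice of a single or double probe at the neighbour [c2] of [i] then always contradicts that
    parity. Two operations pay for the probes at [c2], the others for lifting. *)
Lemma no_detour S r z z' i m i' : stuck (k + 2) S ->
  probe S r z -> probe S r z' -> h r i -> h r i' ->
  ipath h (i :: rcons m i') -> all (off_nbhd h r) m -> m != [::] ->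
  e z (y i) -> ~~ e z (y i') -> e z' (y i') -> ~~ e z' (y i) -> False.
Proof.
move=> stS pz pz' hri hri' c_path off_m m_n0 ezi nezi' ez'i' nez'i.
have [ri _] := stuck_h stS hri; have [ri' _] := stuck_h stS hri'.
have c_uniq := ipath_uniq c_path.
have size_m : size m + 2 <= k.
  by have := max_card (mem (i :: rcons m i')); rewrite card_ord (card_uniqP c_uniq)
    /= size_rcons addn2.
have odd_m : odd (size m).
  apply: (close_double (stuck_le _ stS) pz pz' _ _ c_path off_m ezi nezi' ez'i' nez'i).
  - exact: leq_trans size_m (leq_addr _ _).
  - by rewrite eq_sym.
  - by rewrite eq_sym.
case: m m_n0 c_path off_m c_uniq size_m odd_m => // c2 m _.
rewrite rcons_cons ipath_cons2 => /and4P[iN nhi hic2 c2_path] /andP[off_c2 /= off_m].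
move=> c_uniq size_m odd_m.
have c2N : c2 \notin rcons m i' by move: c_uniq => /= /and3P[].
set s := rcons m i' in c2_path iN nhi c2N.
have s_path : ipath h s by move: c2_path => /= /and4P[].
have [c3 [s' s_eq]] : exists c3 s', s = c3 :: s' by rewrite /s; case: (m) => [|c3
  m']; [exists i', [::]|exists c3, (rcons m' i')].
have size_s : size s = size m + 1 by rewrite size_rcons addn1.
have nhc2 : ~~ has (h c2) s' by move: c2_path; rewrite s_eq ipath_cons2 => /and4P[].
have hc23 : h c2 c3 by move: c2_path; rewrite s_eq ipath_cons2 => /and4P[].
have hc2i : h c2 i by rewrite h_sym.
have /andP[c2r nhrc2] := off_c2.
have rNs : r \notin s by rewrite mem_rcons inE negb_or ri' (off_notin off_m).
have iNc2 : i != c2 by move: iN; rewrite inE negb_or => /andP[].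
have iNs : i \notin s by move: iN; rewrite inE negb_or => /andP[].
(* The same cycle viewed from [c2]: the path now runs from [c3] through [i'] and [r] to [i], and its
   interior has as many vertices as the original one. *)
have rot_path : ipath h (c3 :: rcons (rcons s' r) i).
  rewrite -!rcons_cons -s_eq; apply: (ipath_rcons h_sym h_irr) => //; last by rewrite
    h_sym.
  apply: (ipath_rcons h_sym h_irr) => //.
  - by rewrite (off_notin off_m).
  - by apply/hasPn=> j /(allP off_m) /andP[].
have off_rot : all (off_nbhd h c2) (rcons s' r).
  rewrite all_rcons /off_nbhd eq_sym c2r h_sym nhrc2 /=; apply/allP=> j j_s'.
  rewrite (hasPn nhc2 j j_s') andbT; apply: contraNneq c2N => <-.
  by rewrite s_eq inE j_s' orbT.
have size_s' : size s' = size m by move: size_s; rewrite s_eq addn1 => -[].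
have stS' : stuck k.+2 S by rewrite -addn2.
(* A single probe at [c2] seeing both [i] and [c3] would make that odd number even. Otherwise [t]
   and [t'] see one of them each. *)
have [S1 [sub1 st1 [[t [pt tS eti etc3]]|[t [t' [pt pt']]]]]] := single_or_double
  stS' hc2i hc23.
  have size_rot : size (rcons s' r) = size (c2 :: m) by rewrite size_rcons size_s'.
  have st1' : stuck (size (rcons s' r) + 2) S1 by apply: stuck_le st1; rewrite size_rot.
  by have := close_single st1' pt rot_path off_rot etc3 eti; rewrite size_rot =>
    /negP[].
move=> /andP[tS t'S] /andP[eti netc3] /andP[et'c3 net'i].
have st1' : stuck (size s) S1 by apply: stuck_le st1; apply: leq_trans size_m;
  rewrite size_s /= addSnnS leq_add2l.
have [q q_path al] := chain st1' s_path.
have al' : along S1 (c3 :: s') q by rewrite -s_eq.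
have off_s' : all (off_nbhd h c2) s' by move: off_rot; rewrite all_rcons => /andP[].
have c2N' : c2 \notin c3 :: s' by rewrite -s_eq.
have [[tc2 _ _] [t'c2 _ _]] := (pt, pt').
have [[zr pure_z _] [z'r pure_z' _]] := (pz, pz').
have [[yS indy] _] := stS; have [yiS yii] := yS i.
have tt' : t != t' by apply: contraNneq net'i => <-.
have ett' := X_clique tc2 t'c2 tt'.
have P1 : ipath e (t' :: q) := ipath_cons_along pt' al' q_path c2N' et'c3 (probe_off
  pt' off_s').
have netq : ~~ has (e t) q by rewrite (along_has pt al') /= (negbTE netc3) (probe_off
  pt).
have tq : t \notin q := along_notin al' tc2 c2N'.
have P2 : ipath e [:: t, t' & q].
  by rewrite ipath_cons2 inE negb_or tt' tq netq ett' P1.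
have P3 : ipath e [:: y i, t, t' & q].
  rewrite ipath_cons2 P2 !inE !negb_or (X_neq iNc2 yii tc2) (X_neq iNc2 yii t'c2).
  rewrite (along_notin al yii iNs) [e _ t]e_sym eti /= [e _ t']e_sym net'i.
  by rewrite (along_nonadj stS sub1 al yiS yii iNs nhi).
have probe_nadj z0 : probe S r z0 -> ~~ e z0 t /\ ~~ e z0 t'.
  move=> [z0r pure_z0 hz0]; rewrite (pure_z0 _ _ tS tc2) (pure_z0 _ _ t'S t'c2).
  by split; apply: contra nhrc2; apply: hz0.
have probe_notin z0 : z0 \in X r -> z0 \notin [:: y i, t, t' & q].
  move=> z0r; rewrite !inE !negb_or (X_neq ri z0r yii).
  have rc2 : r != c2 by rewrite eq_sym.
  by rewrite (X_neq rc2 z0r tc2) (X_neq rc2 z0r t'c2) (along_notin al z0r rNs).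
have has_q z0 : probe S r z0 -> has (e z0) q = e z0 (y i').
  move=> pz0; rewrite (along_has (probe_sub sub1 pz0) al) /s has_rcons.
  by rewrite (negbTE (probe_off pz0 off_m)) orbF.
have P4 : ipath e [:: z, y i, t, t' & q].
  have [nezt nezt'] := probe_nadj z pz.
  rewrite ipath_cons2 probe_notin // P3 ezi andbT /= (negbTE nezt) (negbTE nezt').
  by rewrite (has_q z pz) nezi'.
case/lastP: q al P4 probe_notin {q_path al' P1 P2 P3 netq tq has_q} =>
  [/along_size|mq b al P4 probe_notin].
  by rewrite size_s addn1.
have [nez't nez't'] := probe_nadj z' pz'.
have zz' : z' != z by apply: contraNneq nezi' => <-.
have := al; rewrite /s along_rcons => /and3P[al_m bS1 bi'].
have P5 : ipath e (z :: rcons [:: y i, t, t' & mq] b) := P4.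
(* The hole [z], [y i], [t], [t'], [mq], [b], [z'] has doubled probes at both [r] and [c2]; its
   length [size mq + 6] is even. *)
suff: ~~ odd (size [:: y i, t, t' & mq]) by rewrite /= (along_size al_m) odd_m.
apply: (even_hole_free_ipath e_sym e_irr e_ehf P5 (z := z')).
- by apply: contra (probe_notin z' z'r); rewrite !inE mem_rcons inE => /or4P[]->;
  rewrite ?orbT.
- rewrite /= (negbTE nez'i) (negbTE nez't) (negbTE nez't').
  by rewrite (along_has (probe_sub sub1 pz') al_m) (probe_off pz').
- exact: X_clique z'r zr zz'.
- by rewrite (pure_z' _ _ (subsetP sub1 _ bS1) bi').
Qed.

Lemma not_stuck S i j : stuck (2 * k + 4) S -> ~~ h i j.
Proof.
move=> stS; apply/negP=> hij.
have [r l hrl|r [a [hra dom]]] := dominated_vertex h_sym h_irr (ex_intro _ i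
  (ex_intro _ j hij)).
  (* [k] operations yield an incomparable pair, [k + 2] more exclude a detour between its
     targets. *)
  have st' : stuck (k + (k + 2)) S by apply: stuck_le stS; lia.
  have [a [a' [z [z' [S1 [hra hra' sub1 st1 [pz pz']]]]]]] := incomparable_pair st' hrl.
  case/andP=> eza neza' /andP[ez'a' nez'a]; exists a, a'; split=> //.
  have [ra _] := stuck_h st1 hra; have [ra' _] := stuck_h st1 hra'.
  rewrite eq_sym in ra; rewrite eq_sym in ra'.
  have nhaa' := incomparable_unlinked st1 pz pz' ra ra' eza neza' ez'a' nez'a.
  have aa' : a != a' by apply: contraNneq neza' => <-.
  apply/pred0Pn=> -[x /andP[/= x_a x_a']].
  have [m [m_path off_m m_n0]] := pocket_meet_ipath h_sym aa' nhaa' x_a x_a'.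
  exact: no_detour st1 pz pz' hra hra' m_path off_m m_n0 eza neza' ez'a' nez'a.
(* Here every neighbour of [a] is equal or adjacent to [r]. A minimal probe of [X a] misses [y r]
   yet sees some [y b], so [a], [r], [b] is a triangle. *)
have har : h a r by rewrite h_sym.
have st' : stuck 3 S by apply: stuck_le stS; lia.
have [z [S1 [pz nezr sub1 st1 [b hab ezb]]]] := probe_min st' har.
case/orP: (dom b hab) => [/eqP br|hrb]; first by rewrite -br ezb in nezr.
by rewrite (triangle_uniform st1 pz har hrb hab ezb) in nezr.
Qed.

End Rigid.

(** * Destroying all links, then isolating one vertex per clique *)

Definition links S : {set 'I_k * 'I_k} := [set p | linked S p.1 p.2].

(** If no such word removed a link, the link graph of [S] would be rigid, against [not_stuck]. The
    new transversal may differ from [y], as rigidity concerns all transversals. *)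
Lemma links_decrease S y i j : indep_transversal S y -> linked S i j ->
  exists w y', [/\ size w <= 2 * k + 4, indep_transversal (search S w) y'
    & #|links (search S w)| < #|links S|].
Proof.
move=> ty Sij; apply: NNPP => none.
suff st : stuck (linked S) y (2 * k + 4) S.
  by have := not_stuck (@linked_sym S) (@linked_irr S) i j st; rewrite Sij.
split=> // w le_w [y' ty'] i' j'; apply/idP/idP => [|Sij'].
  exact/linked_sub/search_sub.
apply: contraT => nlink; case: none; exists w, y'; split=> //.
apply: proper_card; apply/properP; split.
  by apply/subsetP=> p; rewrite !inE; apply/linked_sub/search_sub.
by exists (i', j'); rewrite !inE.
Qed.

Lemma search_cat S w w' : search S (w ++ w') = search (search S w) w'.
Proof. exact: foldl_cat. Qed.

Lemma unlink_all S y : indep_transversal S y ->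
  exists w y', [/\ size w <= #|links S| * (2 * k + 4),
    indep_transversal (search S w) y' & forall i j, ~~ linked (search S w) i j].
Proof.
have [n] := ubnP #|links S|; elim: n S y => // n IHn S y le_n ty.
have [/existsP[i /existsP[j Sij]]|none] := boolP [exists i, exists j, linked S i j].
  have [w [y' [le_w ty' lt_w]]] := links_decrease ty Sij.
  have [w' [y'' [le_w' ty'' un]]] := IHn _ _ (leq_trans lt_w le_n) ty'.
  exists (w ++ w'), y''; rewrite search_cat; split=> //; rewrite size_cat.
  have := leq_mul lt_w (leqnn (2 * k + 4)); lia.
exists [::], y; split=> // i j; apply: contra none => Sij.
by apply/existsP; exists i; apply/existsP; exists j.
Qed.

(** Without links, the constant answer false is correct for any vertex of [X j]: it removes the rest
    of [X j] and nothing else, and the picked vertex can replace [y j]. *)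
Lemma shrink_cliques S y (js : seq 'I_k) : indep_transversal S y ->
  (forall i j, ~~ linked S i j) -> exists w y', [/\ size w = size js,
    indep_transversal (search S w) y', forall i j, ~~ linked (search S w) i j
    & forall j u, j \in js -> u \in search S w -> u \in X j -> u = y' j].
Proof.
elim: js S y => [|j js IHjs] S y ty un; first by exists [::], y.
have [yS indy] := ty; have [yjS yjj] := yS j.
have [zS zj _] := pickP j true yjS yjj.
pose o : op := (j, j, true, [ffun=> false]); set z := pick _ _ _ _ in zS zj.
have nez i u : u \in S -> u \in X i -> i != j -> ~~ e u z.
  move=> uS ui ij; apply: contra (un i j) => euz; apply/linkedP.
  by split=> //; exists u, z.
pose S1 := keep S o; pose y1 i := if i == j then z else y i.
have S1E u : u \in S1 -> u \in S /\ forall i, u \in X i -> ~~ e u z.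
  rewrite inE => /andP[uS /forallP uz]; split=> // i ui.
  by have := uz i; rewrite ui ffunE => /eqP->.
have S1I i u : u \in S -> u \in X i -> ~~ e u z -> u \in S1.
  by move=> uS ui neuz; rewrite inE uS; apply/forallP=> i'; rewrite ffunE (negbTE
    neuz) eqxx implybT.
have ty1 : indep_transversal S1 y1.
  split=> [i|i i']; rewrite /y1.
    have [->|ij] := eqVneq i j; first by split=> //; apply: (S1I j); rewrite ?e_irr.
    have [yiS yii] := yS i; split=> //; exact: S1I yiS yii (nez _ _ yiS yii ij).
  have [_|ij] := eqVneq i j; have [_|i'j] := eqVneq i' j; rewrite ?e_irr ?indy //.
    by rewrite e_sym; have [? ?] := yS i'; apply: nez i'j.
  by have [? ?] := yS i; apply: nez ij.
have un1 i i' : ~~ linked S1 i i' by apply: contra (un i i'); apply/linked_sub/keep_sub.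
have [w [y' [size_w ty' un' single]]] := IHjs _ _ ty1 un1.
exists (o :: w), y'; split=> //=; first by rewrite size_w.
move=> j' u; rewrite inE => /predU1P[->|j'js] uS uj; last exact: single j'js uS uj.
have Xj v : v \in search S1 w -> v \in X j -> v = z.
  move=> /(subsetP (search_sub _ _))/S1E[_ /(_ j)] nev vj.
  by apply/eqP; apply: contraT => /(X_clique vj zj); rewrite (negbTE (nev vj)).
by case: ty' => /(_ j)[y'S y'j] _; rewrite (Xj u uS uj) (Xj _ y'S y'j).
Qed.

(** There are at most [k ^ 2] linked ordered pairs, each removed at the cost of at most [2 * k + 4]
    operations; one further operation per clique leaves exactly a transversal. *)
Theorem search_complete y : (forall v, exists i, v \in X i) ->
  indep_transversal [set: V] y ->
  exists w, [/\ size w <= k ^ 2 * (2 * k + 4) + k,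
    independent e (search [set: V] w) & #|search [set: V] w| = k].
Proof.
move=> cover ty; have [w [y1 [le_w ty1 un1]]] := unlink_all ty.
have [w' [y2 [size_w' ty2 _ single]]] := shrink_cliques (enum 'I_k) ty1 un1.
rewrite -search_cat in ty2 single; exists (w ++ w').
set S := search _ (w ++ w') in ty2 single *; have [yS indy] := ty2.
have SE : S = [set y2 i | i : 'I_k].
  apply/setP=> u; apply/idP/imsetP => [uS|[i _ ->]]; last by case: (yS i).
  by have [i ui] := cover u; exists i => //; apply: single uS ui; rewrite mem_enum.
split.
- rewrite size_cat size_w' size_enum_ord leq_add2r (leq_trans le_w) // leq_mul2r.
  by apply/orP; right; apply: leq_trans (max_card _) _; rewrite card_prod card_ord.
- rewrite SE; apply/forallP=> u; apply/implyP=> /imsetP[i _ ->].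
  by apply/forallP=> v; apply/implyP=> /imsetP[j _ ->]; rewrite indy.
- rewrite SE card_imset ?card_ord // => i j eq_y.
  by apply: X_disj (yS i).2 _; rewrite eq_y; case: (yS j).
Qed.

End Search.

(** * Structured programs for the random access machine *)

Definition store : Type := (nat -> nat) * (nat -> nat).

Inductive com :=
| Blk of seq instr
| Seq of com & com
| If of nat & com & com
| While of nat & com.

Definition straight (i : instr) : bool :=
  match i with IJump _ | IJumpZ _ _ => false | _ => true end.

Definition act (s : store) (i : instr) : store :=
  let c := exec i (Config 0 s.1 s.2) in (reg c, Defs.mem c).

Definition target (i : instr) : option nat :=
  match i with
  | IConst r _ | IMove r _ | IAdd r _ _ | ISub r _ _ | IHalf r _ | ILoad r _ => Some r
  | _ => None
  end.

Fixpoint writes (c : com) : seq nat :=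
  match c with
  | Blk l => pmap target l
  | Seq a b => writes a ++ writes b
  | If _ a b => writes a ++ writes b
  | While _ a => writes a
  end.

Fixpoint wf (c : com) : bool :=
  match c with
  | Blk l => all straight l
  | Seq a b | If _ a b => wf a && wf b
  | While _ a => wf a
  end.

(* Conditionals and loops test whether the register is nonzero. *)
Fixpoint code (o : nat) (c : com) : program :=
  match c with
  | Blk l => l
  | Seq a b => let p := code o a in p ++ code (o + size p) b
  | If r a b =>
      let p := code o.+1 a in
      let m := o + size p + 2 in
      let q := code m b in
      IJumpZ r m :: p ++ IJump (m + size q) :: q
  | While r a =>
      let p := code o.+1 a in
      IJumpZ r (o + size p + 2) :: rcons p (IJump o)
  end.

(** The number counts machine steps: a first branch or a loop round adds the test and the closing
    jump, a failed test only itself. *)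
Inductive runs : com -> store -> store -> nat -> Prop :=
| RBlk l s : runs (Blk l) s (foldl act s l) (size l)
| RSeq a b s s1 s2 t1 t2 : runs a s s1 t1 -> runs b s1 s2 t2 ->
    runs (Seq a b) s s2 (t1 + t2)
| RIfT r a b s s' t : s.1 r != 0 -> runs a s s' t -> runs (If r a b) s s' (t + 2)
| RIfF r a b s s' t : s.1 r = 0 -> runs b s s' t -> runs (If r a b) s s' (t + 1)
| RWhF r a s : s.1 r = 0 -> runs (While r a) s s 1
| RWhT r a s s1 s2 t1 t2 : s.1 r != 0 -> runs a s s1 t1 ->
    runs (While r a) s1 s2 t2 -> runs (While r a) s s2 (t1 + t2 + 2).

Definition at_pc (o : nat) (s : store) : config := Config o s.1 s.2.

Lemma step_at p q i s :
  step (p ++ i :: q) (at_pc (size p) s) = exec i (at_pc (size p) s).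
Proof. by rewrite /step /= onth_cat ltnn subnn. Qed.

Lemma straight_exec i o s : straight i -> exec i (at_pc o s) = at_pc o.+1 (act s i).
Proof. by case: i. Qed.

(** Jump targets are absolute, so the induction needs arbitrary surrounding code [p] and [q], with
    [size p] as offset. *)
Lemma code_correct c s s' t : runs c s s' t -> wf c -> forall p q,
  iter t (step (p ++ code (size p) c ++ q)) (at_pc (size p) s)
    = at_pc (size p + size (code (size p) c)) s'.
Proof.
elim=> {c s s' t}.
- elim=> [|i l IHl] s /=; first by move=> _ p q; rewrite addn0.
  case/andP=> str_i str_l p q.
  have := IHl (act s i) str_l (rcons p i) q.
  rewrite size_rcons cat_rcons /= -iterS iterSr step_at straight_exec // => ->.
  by rewrite addSnnS.
- move=> a b s s1 s2 t1 t2 _ IHa _ IHb /andP[wf_a wf_b] p q.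
  rewrite /= addnC iterD -!catA IHa // catA -size_cat IHb //.
  by rewrite !size_cat addnA.
- move=> r a b s s' t nz _ IHa /andP[wf_a wf_b] p q /=.
  set pa := code (size p).+1 a; set pb := code _ b.
  rewrite addn2 iterS iterSr.
  set pr := p ++ _.
  have -> : step pr (at_pc (size p) s) = at_pc (size (rcons p (IJumpZ r (size p +
    size pa + 2)))) s.
    by rewrite /pr /= step_at /= (negbTE nz) size_rcons.
  have -> : pr = rcons p (IJumpZ r (size p + size pa + 2)) ++ code (size (rcons p
    (IJumpZ r (size p + size pa + 2)))) a ++ (IJump (size p + size pa + 2 + size pb)
    :: pb ++ q).
    by rewrite /pr size_rcons cat_rcons /= -/pa -catA.
  rewrite IHa // size_rcons -/pa catA.
  have -> : (size p).+1 + size pa = size (rcons p (IJumpZ r (size p + size pa + 2))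
    ++ pa).
    by rewrite size_cat size_rcons.
  by rewrite step_at /= !size_cat /= /at_pc; congr Config; lia.
- move=> r a b s s' t z _ IHb /andP[wf_a wf_b] p q /=.
  set pa := code (size p).+1 a; set pb := code _ b.
  rewrite addn1 iterSr.
  set pr := p ++ _.
  pose p' := p ++ IJumpZ r (size p + size pa + 2) :: pa ++ [:: IJump (size p + size
    pa + 2 + size pb)].
  have sz : size p' = size p + size pa + 2 by rewrite /p' size_cat /= size_cat /=; lia.
  have -> : step pr (at_pc (size p) s) = at_pc (size p') s.
    by rewrite /pr /= step_at /= z eqxx sz.
  have -> : pr = p' ++ code (size p') b ++ q.
    by rewrite sz -/pb /pr /p' -!catA /= -!catA.
  by rewrite IHb // sz -/pb /at_pc !size_cat /=; congr Config; lia.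
- move=> r a s z wf_a p q; rewrite /= step_at /= z eqxx /at_pc; congr Config.
  by rewrite size_rcons; lia.
- move=> r a s s1 s2 t1 t2 nz _ IHa _ IHw wf_a p q.
  have {}IHw := IHw wf_a p q.
  set pr := p ++ _ ++ q in IHw *; set pa := code (size p).+1 a.
  have e1 : step pr (at_pc (size p) s) = at_pc (size (rcons p (IJumpZ r (size p +
    size pa + 2)))) s.
    by rewrite /pr /= step_at /= (negbTE nz) size_rcons.
  have e2 : pr = rcons p (IJumpZ r (size p + size pa + 2)) ++ code (size (rcons p
    (IJumpZ r (size p + size pa + 2)))) a ++ (IJump (size p) :: q).
    by rewrite /pr size_rcons cat_rcons /= -/pa -cats1 -catA.
  have e3 : iter t1 (step pr) (step pr (at_pc (size p) s)) = at_pc (size (rcons p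
    (IJumpZ r (size p + size pa + 2)) ++ pa)) s1.
    by rewrite e1 e2 IHa // size_cat !size_rcons.
  have e4 : step pr (at_pc (size (rcons p (IJumpZ r (size p + size pa + 2)) ++ pa))
    s1) = at_pc (size p) s1.
    by rewrite e2 size_rcons -/pa catA step_at.
  have -> : t1 + t2 + 2 = t2 + (t1.+1).+1 by lia.
  by rewrite iterD iterS iterSr e3 e4 IHw.
Qed.

Lemma code_runs c input s t : runs c (fun=> 0, nth 0 input) s t -> wf c ->
  runs_in (code 0 c) input t (mkseq s.2 (s.1 0)).
Proof.
move=> run_c wf_c; have := code_correct run_c wf_c [::] [::].
rewrite cats0 add0n /= /runs_in => E.
have -> : initial input = at_pc 0 (fun=> 0, nth 0 input) by [].
by rewrite E /halted /= leqnn.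
Qed.

(** A frame condition on registers alone; memory is described by the postconditions. *)
Definition agree (L : seq nat) (s s' : store) : Prop :=
  forall r, r \notin L -> s'.1 r = s.1 r.

Lemma act_agree s i : agree (pmap target [:: i]) s (act s i).
Proof.
by case: i => [r c|r a|r a b|r a b|r a|r a|a b|l|a l] x //; rewrite ?inE /= /update
  => /negPf->.
Qed.

Lemma runs_agree c s s' t : runs c s s' t -> agree (writes c) s s'.
Proof.
elim=> {c s s' t} //.
- elim=> [|i l IHl] s //= r; rewrite -/(pmap target (i :: l)) -cat1s pmap_cat mem_cat
  negb_or.
  by case/andP=> ri rl; rewrite IHl // (act_agree s ri).
- move=> a b s s1 s2 t1 t2 _ IHa _ IHb r; rewrite mem_cat negb_or => /andP[ra rb].
  by rewrite IHb ?IHa.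
- by move=> r a b s s' t _ _ IHa x; rewrite mem_cat negb_or => /andP[/IHa].
- by move=> r a b s s' t _ _ IHb x; rewrite mem_cat negb_or => /andP[_ /IHb].
- by move=> r a s s1 s2 t1 t2 _ _ IHa _ IHw x xa; rewrite IHw ?IHa.
Qed.

(** Total correctness from the store [s], with time bound [T]. *)
Definition ok (c : com) (s : store) (T : nat) (Q : store -> Prop) : Prop :=
  exists s' t, [/\ runs c s s' t, t <= T & Q s'].

Lemma ok_frame c s T (Q : store -> Prop) : ok c s T Q ->
  ok c s T (fun s' => Q s' /\ agree (writes c) s s').
Proof.
by move=> [s' [t [rc le_t q]]]; exists s', t; split=> //; split=> //; apply:
  runs_agree rc.
Qed.

Lemma ok_weaken c s T T' (Q Q' : store -> Prop) : ok c s T Q -> T <= T' ->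
  (forall s', Q s' -> Q' s') -> ok c s T' Q'.
Proof. by move=> [s' [t [rc le_t q]]] le_T QQ'; exists s', t; split; [|lia|apply:
  QQ']. Qed.

Lemma ok_blk l s (Q : store -> Prop) : Q (foldl act s l) -> ok (Blk l) s (size l) Q.
Proof. by move=> q; exists (foldl act s l), (size l); split=> //; constructor. Qed.

Lemma ok_seq a b s T1 T2 (P Q : store -> Prop) : ok a s T1 P ->
  (forall s', P s' -> ok b s' T2 Q) -> ok (Seq a b) s (T1 + T2) Q.
Proof.
move=> [s1 [t1 [r1 le1 p1]]] /(_ _ p1)[s2 [t2 [r2 le2 q2]]].
by exists s2, (t1 + t2); split=> //; [exact: RSeq r1 r2 | lia].
Qed.

Lemma ok_if r a b s Ta Tb (Q : store -> Prop) :
  (s.1 r != 0 -> ok a s Ta Q) -> (s.1 r = 0 -> ok b s Tb Q) ->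
  ok (If r a b) s (maxn Ta Tb + 2) Q.
Proof.
move=> oka okb; have [z|nz] := eqVneq (s.1 r) 0.
  have [s' [t [rb le q]]] := okb z.
  by exists s', (t + 1); split=> //; [exact: RIfF | lia].
have [s' [t [ra le q]]] := oka nz.
by exists s', (t + 2); split=> //; [exact: RIfT | lia].
Qed.

(** The index of [Inv] is a variant lowered by every round, so its initial value [N] bounds the
    number of rounds. *)
Lemma ok_while r a T N (Inv : nat -> store -> Prop) s (Q : store -> Prop) :
  Inv N s ->
  (forall m s1, agree (writes a) s s1 -> Inv m s1 -> s1.1 r != 0 ->
     ok a s1 T (fun s' => exists2 m', m' < m & Inv m' s')) ->
  (forall m s1, agree (writes a) s s1 -> Inv m s1 -> s1.1 r = 0 -> Q s1) ->
  ok (While r a) s (N * (T + 2) + 1) Q.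
Proof.
move=> inv0 body post; have : agree (writes a) s s by [].
move: {-2}s inv0 => s0; elim/ltn_ind: N s0 => N IHN s0 inv ag.
have [z|nz] := eqVneq (s0.1 r) 0.
  by exists s0, 1; split; [exact: RWhF | lia | exact: post inv z].
have [s1 [t1 [r1 le1 [m lt_m inv1]]]] := body _ _ ag inv nz.
have ag1 : agree (writes a) s s1 by move=> x xa; rewrite (runs_agree r1) ?ag.
have [s2 [t2 [r2 le2 q2]]] := IHN m lt_m s1 inv1 ag1.
exists s2, (t1 + t2 + 2); split=> //; first exact: RWhT nz r1 r2.
have : m.+1 * (T + 2) <= N * (T + 2) by rewrite leq_mul2r lt_m orbT.
rewrite mulSn; lia.
Qed.

Lemma ok_le c s T T' Q : ok c s T Q -> T <= T' -> ok c s T' Q.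
Proof. by move=> okc le_T; apply: ok_weaken okc le_T _. Qed.

(* Register 4 holds the constant 1 throughout. *)
Definition For (v d b : nat) (body : com) : com :=
  Seq (Blk [:: IConst v 0; ISub d b v])
      (While d (Seq body (Blk [:: IAdd v v 4; ISub d b v]))).

(** [d] holds the number of rounds left and serves as the variant. [Inv] must tolerate changes of
    [v] and [d], which the loop itself updates. *)
Lemma ok_for v d b body T N (Inv : nat -> store -> Prop) s (Q : store -> Prop) :
  uniq [:: v; d; b; 4] -> all (fun r => r \notin writes body) [:: v; b; 4] ->
  s.1 4 = 1 -> s.1 b = N ->
  (forall i s1 s2, Inv i s1 -> s2.2 = s1.2 -> agree [:: v; d] s1 s2 -> Inv i s2) ->
  Inv 0 s ->
  (forall i s1, i < N -> s1.1 v = i -> agree [:: v, d & writes body] s s1 ->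
     Inv i s1 -> ok body s1 T (Inv i.+1)) ->
  (forall s1, agree [:: v, d & writes body] s s1 -> Inv N s1 -> Q s1) ->
  ok (For v d b body) s (N * (T + 4) + 3) Q.
Proof.
move=> dist fresh s4 sb stable inv0 step post.
move: fresh => /= /and4P[v_w b_w w4 _].
move: dist; rewrite /= !inE !negb_or => /and4P[/and3P[vd vb v4] /andP[db d4] b4 _].
have [bNv dNv] := (negPf vb, negPf vd).
pose J m s1 := exists2 i, [/\ i + m = N, s1.1 v = i & s1.1 d = m] &
  agree [:: v, d & writes body] s s1 /\ Inv i s1.
apply: (@ok_weaken _ _ (2 + (N * (T + 2 + 2) + 1)) _ Q); [|lia|by []].
apply: (@ok_seq _ _ _ 2 _ (J N)).
  apply: ok_blk; rewrite /= /act /=; exists 0.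
    split; rewrite /update /= ?eqxx ?dNv //.
    by rewrite [b == v]eq_sym bNv subn0 sb.
  split; last by apply: stable inv0 _ _ => // r; rewrite !inE negb_or /update /= =>
    /andP[/negPf-> /negPf->].
  by move=> r; rewrite !inE !negb_or /update /= => /and3P[/negPf-> /negPf-> _].
move=> s1 J1; apply: (ok_while J1) => [m s2 _ [i [im vi di] [ag inv]] nz|m s2 _ [i
  [im vi di] [ag inv]] z]; last first.
  by apply: post => //; have -> : N = i by lia.
have lt_i : i < N by lia.
apply: ok_seq (ok_frame (step i s2 lt_i vi ag inv)) _ => s3 [inv3 ag3].
have v3 : s3.1 v = i by rewrite ag3.
have s34 : s3.1 4 = 1 by rewrite ag3 // ag // !inE !negb_or ![4 == _]eq_sym v4 d4.
have s3b : s3.1 b = N by rewrite ag3 // ag // !inE !negb_or ![b == _]eq_sym vb db b_w.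
apply: ok_blk; exists m.-1; first by lia.
exists i.+1.
  split; rewrite /= /update /= ?eqxx ?vNd ?bNv; try by lia.
  - by rewrite (negPf vd) v3 s34 addn1.
  - by rewrite [b == v]eq_sym bNv s3b v3 s34; lia.
split; last by apply: stable inv3 _ _ => // r; rewrite !inE negb_or /= /update =>
  /andP[/negPf-> /negPf->].
move=> r; rewrite !inE !negb_or /= /update => /and3P[rv rd rw].
by rewrite (negPf rv) (negPf rd) ag3 // ag // !inE !negb_or rv rd.
Qed.

(** * The program *)

(* Registers: 0 output length, 1 n, 2 k, 3 the base k + 2, 4 the constant 1,
   5 address of the clique vectors, 6 address of the vector of surviving
   vertices (written after the input), 8 words still to be tried, 9 current
   word, 10 success flag, 15-17 the operation (j, l, x), 18 the vertex picked,
   20-21 current clique and answer bit; the others are scratch. *)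
Definition skip : com := Blk [::].

Definition MUL (d a b : nat) : com :=
  Seq (Blk [:: IConst d 0; IMove 11 b])
      (While 11 (Blk [:: IAdd d d a; ISub 11 11 4])).

Definition ADJ (u v : nat) : com :=
  Seq (MUL 12 u 1) (Blk [:: IAdd 12 12 v; IAdd 12 12 4; IAdd 12 12 4; ILoad 12 12]).

(** The clique number may be a decoded digit as large as [k + 1], so it is compared with [k] before
    the clique vector is read. *)
Definition INY (i v : nat) : com :=
  Seq (Blk [:: ISub 12 2 i])
    (If 12 (Seq (MUL 12 i 1)
             (Seq (Blk [:: IAdd 12 12 5; IAdd 12 12 v; ILoad 12 12])
                  (If 12 (Blk [:: IAdd 12 6 v; ILoad 12 12]) skip)))
        skip).

(** Division of register 9 by the base through repeated subtraction; adding 1 before subtracting the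
    base tests whether the remainder is at least the base. *)
Definition DIGIT (r : nat) : com :=
  Seq (Blk [:: IConst 13 0; IMove r 9; IAdd 14 r 4; ISub 14 14 3])
    (Seq (While 14 (Blk [:: ISub r r 3; IAdd 13 13 4; IAdd 14 r 4; ISub 14 14 3]))
         (Blk [:: IMove 9 13])).

Definition COUNT : com :=
  Seq (Blk [:: IConst 26 0])
    (For 24 25 1 (Seq (INY 16 24)
      (If 12 (Seq (ADJ 22 24) (If 12 (Blk [:: IAdd 26 26 4]) skip)) skip))).

(** Both criteria become maximisation of a positive number, so that every candidate beats the
    initial value 0 of [PICK]. *)
Definition VALUE : com :=
  Seq COUNT (If 17 (Blk [:: IAdd 27 26 4]) (Blk [:: IAdd 27 1 4; ISub 27 27 26])).

Definition PICK : com :=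
  Seq (Blk [:: IConst 18 0; IConst 19 0])
    (For 22 23 1 (Seq (INY 15 22)
      (If 12 (Seq VALUE (Seq (Blk [:: ISub 31 27 19])
                (If 31 (Blk [:: IMove 19 27; IMove 18 22]) skip)))
          skip))).

Definition KILL : com := Blk [:: IAdd 31 6 22; IConst 12 0; IStore 31 12].

Definition FILTER : com :=
  For 22 23 1 (Seq (INY 20 22)
    (If 12 (Seq (ADJ 22 18) (If 12 (If 21 skip KILL) (If 21 KILL skip))) skip)).

Definition OP : com :=
  Seq (DIGIT 15) (Seq (DIGIT 16) (Seq (DIGIT 17) (Seq PICK
    (For 20 28 2 (Seq (DIGIT 21) FILTER))))).

Definition RESET : com := For 22 23 1 (Blk [:: IAdd 12 6 22; IStore 12 4]).

Definition WORD : com :=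
  Seq RESET (Seq (Blk [:: IAdd 29 9 4; ISub 29 29 3])
    (While 29 (Seq OP (Blk [:: IAdd 29 9 4; ISub 29 29 3])))).

Definition ALIVE (v : nat) : com := Blk [:: IAdd 12 6 v; ILoad 12 12].

(** On success, clearing register 8 stops the enumeration while the surviving set is still in
    memory. *)
Definition CHECK : com :=
  Seq (Blk [:: IConst 32 0; IConst 30 1])
    (Seq (For 22 23 1 (Seq (ALIVE 22)
           (If 12 (Seq (Blk [:: IAdd 32 32 4])
               (For 24 25 1 (Seq (ALIVE 24)
                  (If 12 (Seq (ADJ 22 24) (If 12 (Blk [:: IConst 30 0]) skip)) skip))))
               skip)))
         (Seq (Blk [:: ISub 31 32 2; ISub 12 2 32; IAdd 31 31 12])
              (If 31 skip (If 30 (Blk [:: IConst 10 1; IConst 8 0]) skip)))).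

Definition OUTPUT : com :=
  Seq (Blk [:: IConst 12 0; IStore 12 4; IConst 0 1])
    (For 22 23 1 (Seq (ALIVE 22) (If 12 (Blk [:: IStore 0 22; IAdd 0 0 4]) skip))).

Definition FAIL : com := Blk [:: IConst 12 0; IStore 12 12; IConst 0 1].

(** Three squarings of [k + 3] give the number of doublings that produce [2 ^ ((k + 3) ^ 8)], the
    number of words to try. *)
Definition INIT : com :=
  Seq (Blk [:: IConst 4 1; ILoad 1 0; ILoad 2 4; IAdd 3 2 4; IAdd 3 3 4; IAdd 33 3 4])
    (Seq (MUL 5 1 1) (Seq (Blk [:: IAdd 5 5 4; IAdd 5 5 4])
    (Seq (MUL 6 2 1) (Seq (Blk [:: IAdd 6 6 5])
    (Seq (MUL 34 33 33) (Seq (MUL 35 34 34) (Seq (MUL 36 35 35)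
    (Seq (Blk [:: IConst 8 1])
         (While 36 (Blk [:: IAdd 8 8 8; ISub 36 36 4])))))))))).

Definition MAIN : com :=
  Seq INIT
    (Seq (While 8 (Seq (Blk [:: ISub 8 8 4; IMove 9 8]) (Seq WORD CHECK)))
         (If 10 OUTPUT FAIL)).

(* Locked, lest [/=] unfold [upto i.+1] from the left. *)
Definition upto (i : nat) : seq nat := locked (iota 0 i).

Lemma uptoE i : upto i = iota 0 i.
Proof. by rewrite /upto -lock. Qed.

Lemma upto0 : upto 0 = [::].
Proof. exact: uptoE. Qed.

Lemma uptoS i : upto i.+1 = rcons (upto i) i.
Proof. by rewrite !uptoE -addn1 iotaD cats1. Qed.

(** * Arithmetic meaning and cost of each routine *)

Section Machine.

Variables (n k : nat) (M0 : nat -> nat).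

Let B := k + 2.
Let AL := 2 + n * n + k * n.

Definition ad (u v : nat) : bool := M0 (2 + u * n + v) != 0.
Definition mb (i v : nat) : bool := (i < k) && (M0 (2 + n * n + i * n + v) != 0).
Definition inY (A : pred nat) (i v : nat) : bool := mb i v && A v.
Definition cnt (A : pred nat) (l v : nat) : nat :=
  count (fun w => inY A l w && ad v w) (upto n).
Definition value (A : pred nat) (l x v : nat) : nat :=
  if x != 0 then (cnt A l v).+1 else n.+1 - cnt A l v.
Definition pick_step (A : pred nat) (j l x : nat) (zb : nat * nat) (v : nat) :=
  if inY A j v && (zb.2 < value A l x v) then (v, value A l x v) else zb.
Definition pick_nat (A : pred nat) (j l x : nat) : nat :=
  (foldl (pick_step A j l x) (0, 0) (upto n)).1.
Definition filt (A : pred nat) (i : nat) (b : bool) (z : nat) : pred nat :=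
  fun w => A w && ~~ (inY A i w && (ad w z != b)).
Definition filt_step (z : nat) (WA : nat * pred nat) (i : nat) :=
  (WA.1 %/ B, filt WA.2 i (WA.1 %% B != 0) z).
(** Digits are read from the least significant one: [j], [l], [x], then one answer per clique. *)
Definition op_nat (W : nat) (A : pred nat) : nat * pred nat :=
  let z := pick_nat A (W %% B) (W %/ B %% B) (W %/ B %/ B %% B) in
  foldl (filt_step z) (W %/ B %/ B %/ B, A) (upto k).

(* Below the base only the final marker of a word is left. *)
Inductive decodes : nat -> pred nat -> pred nat -> Prop :=
| DecNil W A : W < B -> decodes W A A
| DecCons W A A' : B <= W ->
    decodes (op_nat W A).1 (op_nat W A).2 A' -> decodes W A A'.

Definition success (A : pred nat) : bool :=
  (count A (upto n) == k) &&
  all (fun u => A u ==> all (fun v => A v ==> ~~ ad u v) (upto n)) (upto n).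

Definition env (R : nat -> nat) : Prop :=
  [/\ R 1 = n, R 2 = k, R 3 = B, R 4 = 1 & R 5 = 2 + n * n /\ R 6 = AL].

Definition inp (M : nat -> nat) : Prop := forall a, a < AL -> M a = M0 a.

Definition memok (A : pred nat) (M : nat -> nat) : Prop :=
  inp M /\ forall v, v < n -> M (AL + v) = A v.

Lemma env_agree L s s' : agree L s s' -> all (fun r => r \notin L) (iota 1 6) ->
  env s.1 -> env s'.1.
Proof.
move=> ag /allP fresh [e1 e2 e3 e4 [e5 e6]].
by split; rewrite ?ag ?fresh.
Qed.

Lemma mul_ok d a b s N : uniq [:: d; 11; 4] -> a \notin [:: d; 11] -> b != d ->
  s.1 4 = 1 -> s.1 b = N ->
  ok (MUL d a b) s (4 * N + 3)
    (fun s' => s'.1 d = s.1 a * N /\ s'.2 = s.2).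
Proof.
move=> + + + + <-.
rewrite /= !inE !negb_or => /andP[/andP[d11 d4] _] /andP[ad' a11] bd s4.
eapply ok_le.
  apply: (@ok_seq _ _ _ _ _ (fun s1 => [/\ s1.1 d = 0, s1.1 11 = s.1 b, s1.1 a = s.1
    a, s1.1 4 = 1 & s1.2 = s.2])).
    apply: ok_blk; rewrite /= /update /= eqxx [4 == d]eq_sym (negPf d11) (negPf d4).
    by rewrite (negPf bd) (negPf ad') (negPf a11).
  move=> s1 [s1d s111 s1a s14 s1m].
  apply: (@ok_while _ _ _ (s.1 b) (fun m s2 => [/\ s2.1 11 = m, s2.1 d + s.1 a * m =
    s.1 a * s.1 b & s2.2 = s.2])).
  - by rewrite s1d.
  - move=> m s2 ag [s211 s2d s2m] nz; apply: ok_blk; exists m.-1; first by lia.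
    have s2a : s2.1 a = s.1 a by rewrite ag // !inE negb_or ad'.
    have s24 : s2.1 4 = 1 by rewrite ag // !inE negb_or eq_sym d4.
    rewrite /= /update /= [11 == d]eq_sym [4 == d]eq_sym (negPf d11) (negPf d4) eqxx.
    split=> //=; first by lia.
    by rewrite s2a -s2d -addnA -mulnS prednK //; lia.
  - by move=> m s2 _ [s211 s2d s2m] z; rewrite -s2d -s211 z muln0 addn0.
rewrite /= ?maxn0; nia.
Qed.

Lemma adj_ok A u v s : u \notin [:: 11; 12] -> v \notin [:: 11; 12] ->
  env s.1 -> memok A s.2 -> s.1 u < n -> s.1 v < n ->
  ok (ADJ u v) s (4 * n + 7)
    (fun s' => s'.2 = s.2 /\ (s'.1 12 != 0) = ad (s.1 u) (s.1 v)).
Proof.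
rewrite !inE !negb_or => /andP[u11 u12] /andP[v11 v12] env_s [inps _] lt_u lt_v.
have [s1 s2 s3 s4 _] := env_s.
eapply ok_le.
  apply: ok_seq; first apply/ok_frame/(@mul_ok _ _ _ _ n); rewrite ?inE ?negb_or ?u11
    ?u12 //.
  move=> s' [[s'12 s'm] ag]; apply: ok_blk; rewrite /= /update /=.
  have -> : s'.1 v = s.1 v by rewrite ag // !inE !negb_or v11 v12.
  have -> : s'.1 4 = 1 by rewrite ag.
  split=> //; rewrite s'm s'12 inps; last by rewrite /AL; nia.
  by rewrite /ad; congr (M0 _ != 0); lia.
rewrite /= ?maxn0; nia.
Qed.

Lemma iny_ok A i v s : i \notin [:: 11; 12] -> v \notin [:: 11; 12] ->
  env s.1 -> memok A s.2 -> s.1 v < n ->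
  ok (INY i v) s (4 * n + 14)
    (fun s' => s'.2 = s.2 /\ (s'.1 12 != 0) = inY A (s.1 i) (s.1 v)).
Proof.
rewrite !inE !negb_or => /andP[i11 i12] /andP[v11 v12] env_s [inps alive] lt_v.
have [s1 s2 s3 s4 [s5 s6]] := env_s.
eapply ok_le.
  apply: (@ok_seq _ _ _ _ _ (fun s' => [/\ agree [:: 12] s s', s'.2 = s.2 & s'.1 12 =
    k - s.1 i])).
    apply: ok_blk; split=> //=; rewrite /update /= ?s2 //.
    by move=> r; rewrite inE /= /update => /negPf->.
  move=> s' [ag s'm s'12]; apply: ok_if => [nz|z]; last first.
    apply: ok_blk; split=> //=; rewrite z /inY /mb; have -> : s.1 i < k = false by
      rewrite -subn_gt0 -s'12 z.
    by [].
  have lt_i : s.1 i < k by rewrite -subn_gt0 -s'12 lt0n.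
  have env' := env_agree ag isT env_s; have [s'1 _ _ s'4 _] := env'.
  apply: ok_seq; first apply/ok_frame/(@mul_ok _ _ _ _ n); rewrite ?inE ?negb_or ?i11
    ?i12 //.
  move=> s'' [[s''12 s''m] ag'].
  have s''5 : s''.1 5 = 2 + n * n by rewrite ag' // ag.
  have s''6 : s''.1 6 = AL by rewrite ag' // ag.
  have s''v : s''.1 v = s.1 v by rewrite ag' ?ag ?inE ?negb_or ?v11 ?v12.
  have s'i : s'.1 i = s.1 i by rewrite ag ?inE.
  rewrite s'i in s''12.
  have addr : s.1 i * n + (2 + n * n) + s.1 v < AL by rewrite /AL; nia.
  have mbE : mb (s.1 i) (s.1 v) = (M0 (s.1 i * n + (2 + n * n) + s.1 v) != 0).
    by rewrite /mb lt_i; congr (M0 _ != 0); lia.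
  apply: (@ok_seq _ _ _ _ _ (fun t => [/\ agree [:: 12] s'' t, t.2 = s.2 & (t.1 12 !=
    0) = mb (s.1 i) (s.1 v)])).
    apply: ok_blk; split=> /=.
    - by move=> r; rewrite inE /= /update => /negPf rN; rewrite !rN.
    - by rewrite s''m.
    - by rewrite /update /= (negPf v12) s''12 s''5 s''v s''m s'm inps // mbE.
  move=> t [agt tm t12]; apply: ok_if => [nzt|zt]; apply: ok_blk; split=> //=.
  - rewrite /update /= !agt ?inE // tm s''6 s''v alive //.
    by rewrite /inY -t12 nzt; case: (A _).
  - by rewrite zt /inY -t12 zt.
rewrite /= ?maxn0; nia.
Qed.

Lemma digit_ok r s W : r \notin [:: 3; 4; 9; 13; 14] -> env s.1 -> s.1 9 = W ->
  ok (DIGIT r) s (6 * W + 6)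
    (fun s' => [/\ s'.2 = s.2, s'.1 r = W %% B & s'.1 9 = W %/ B]).
Proof.
rewrite !inE !negb_or => /and5P[r3 r4 r9 r13 r14] env_s s9.
have [s1 s2 s3 s4 _] := env_s.
have [r3' r4'] : 3 == r = false /\ 4 == r = false by rewrite ![_ == r]eq_sym !(negPf
  r3, negPf r4).
have [r9' r13'] : 9 == r = false /\ 13 == r = false by rewrite ![_ == r]eq_sym
  !(negPf r9, negPf r13).
have r14' : 14 == r = false by rewrite eq_sym (negPf r14).
(* Register 13 is the quotient so far, [r] the remainder, and register 14 is nonzero as long as the
   base can still be subtracted. *)
pose I m s1 := [/\ s1.1 r = m, s1.1 14 = m + 1 - B, s1.1 13 * B + m = W & s1.2 = s.2].
eapply ok_le.
  apply: (@ok_seq _ _ _ _ _ (fun s1 => [/\ I W s1, s1.1 3 = B & s1.1 4 = 1])).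
    apply: ok_blk; rewrite /I /= /update /= ?eqxx.
    rewrite !(negPf r3, negPf r4, negPf r9, negPf r13, negPf r14, r3', r4', r9',
      r13', r14') /=.
    by rewrite s3 s4 s9.
  move=> s' [I1 s'3 s'4]; apply: (@ok_seq _ _ _ _ _ (fun s1 => I (W %% B) s1 /\ s1.1
    13 = W %/ B)).
    apply: (ok_while I1) => m t ag [tr t14 tW tm].
      rewrite t14 => nz; have le_m : B <= m by lia.
      have t3 : t.1 3 = B by rewrite ag // !inE !negb_or r3'.
      have t4 : t.1 4 = 1 by rewrite ag // !inE !negb_or r4'.
      apply: ok_blk; exists (m - B); first by rewrite /B; lia.
      rewrite /I /= /update /= ?eqxx.
      rewrite !(negPf r3, negPf r4, negPf r9, negPf r13, negPf r14, r3', r4', r9',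
        r13', r14') /=.
      by rewrite t3 t4 tr; split=> //; rewrite mulnDl mul1n -addnA subnKC.
    rewrite t14 => z; have lt_m : m < B by lia.
    have [<- <-] : m = W %% B /\ t.1 13 = W %/ B.
      by rewrite -tW modnMDl modn_small // divnMDl ?divn_small ?addn0 // /B; lia.
    by [].
  move=> t [[tr t14 tW tm] t13]; apply: ok_blk; rewrite /= /update /= ?eqxx (negPf r9).
  by [].
rewrite /= ?maxn0; nia.
Qed.

Lemma count_uptoS (P : pred nat) i : count P (upto i.+1) = count P (upto i) + P i.
Proof. by rewrite uptoS -cats1 count_cat /= addn0. Qed.

Lemma count_ok A s : env s.1 -> memok A s.2 -> s.1 22 < n ->
  ok COUNT s (n * (8 * n + 32) + 4)
    (fun s' => s'.2 = s.2 /\ s'.1 26 = cnt A (s.1 16) (s.1 22)).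
Proof.
move=> env_s ms lt_v.
pose P w := inY A (s.1 16) w && ad (s.1 22) w.
eapply ok_le.
  apply: (@ok_seq _ _ _ _ _ (fun s1 => [/\ agree [:: 26] s s1, s1.2 = s.2 & s1.1 26 =
    0])).
    apply: ok_blk; split=> //= r; by rewrite inE /= /update => /negPf->.
  move=> s1 [ag1 s1m s126]; have env1 := env_agree ag1 isT env_s.
  have [s11 s12 s13 s14 [s15 s16]] := env1.
  apply: (@ok_for _ _ _ _ _ n (fun i t => t.2 = s.2 /\ t.1 26 = count P (upto i))) =>
    //.
  - by move=> i t t' [tm t26] -> ag; rewrite ag.
  - by rewrite upto0.
  - move=> i t lt_i t24 ag [tm t26]; have envt := env_agree ag isT env1.
    have mt : memok A t.2 by rewrite tm.
    have t16 : t.1 16 = s.1 16 by rewrite ag // ag1.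
    have t22 : t.1 22 = s.1 22 by rewrite ag // ag1.
    apply: ok_seq; first by apply/ok_frame/(iny_ok _ _ envt mt); rewrite ?t24.
    move=> t1 [[t1m t112] ag']; rewrite t24 t16 in t112.
    have env1' := env_agree ag' isT envt; have mt1 : memok A t1.2 by rewrite t1m.
    have t124 : t1.1 24 = i by rewrite ag'.
    have t122 : t1.1 22 = s.1 22 by rewrite ag'.
    have t126 : t1.1 26 = count P (upto i) by rewrite ag'.
    apply: ok_if => [nz|z]; last first.
      apply: ok_blk; rewrite /= t1m tm t126 count_uptoS /P -t112 z.
      by rewrite addn0.
    apply: ok_seq; first by apply/ok_frame/(adj_ok _ _ env1' mt1); rewrite ?t124 ?t122.
    move=> t2 [[t2m t212] ag'']; rewrite t124 t122 in t212.
    have t226 : t2.1 26 = count P (upto i) by rewrite ag''.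
    have [_ _ _ t24' _] := env_agree ag'' isT env1'.
    apply: ok_if => [nz'|z']; apply: ok_blk; rewrite /= ?/update /= t2m t1m tm
      count_uptoS /P -t112 nz.
      by rewrite t226 t24' -t212 nz'.
    by rewrite t226 -t212 z' addn0.
rewrite /= ?maxn0; nia.
Qed.

Lemma value_ok A s : env s.1 -> memok A s.2 -> s.1 22 < n ->
  ok VALUE s (n * (8 * n + 32) + 8)
    (fun s' => s'.2 = s.2 /\ s'.1 27 = value A (s.1 16) (s.1 17) (s.1 22)).
Proof.
move=> env_s ms lt_v; eapply ok_le.
  apply: ok_seq; first exact/ok_frame/(count_ok env_s ms lt_v).
  move=> s1 [[s1m s126] ag]; have [s11 _ _ s14 _] := env_agree ag isT env_s.
  have s117 : s1.1 17 = s.1 17 by rewrite ag.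
  apply: ok_if => nz; apply: ok_blk; rewrite /= /update /= s1m s126 s14 /value -s117.
    by rewrite nz addn1.
  by rewrite nz s11 addn1.
rewrite /= ?maxn0; nia.
Qed.

Lemma foldl_uptoS T (f : T -> nat -> T) z i :
  foldl f z (upto i.+1) = f (foldl f z (upto i)) i.
Proof. by rewrite uptoS foldl_rcons. Qed.

Lemma pick_ok A s : env s.1 -> memok A s.2 ->
  ok PICK s (n * (n * (8 * n + 32) + 4 * n + 40) + 5)
    (fun s' => s'.2 = s.2 /\ s'.1 18 = pick_nat A (s.1 15) (s.1 16) (s.1 17)).
Proof.
move=> env_s ms.
pose f := pick_step A (s.1 15) (s.1 16) (s.1 17).
pose I i t := [/\ t.2 = s.2, t.1 18 = (foldl f (0, 0) (upto i)).1
  & t.1 19 = (foldl f (0, 0) (upto i)).2].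
eapply ok_le.
  apply: (@ok_seq _ _ _ _ _ (fun s1 => agree [:: 18; 19] s s1 /\ I 0 s1)).
    apply: ok_blk; split; last by rewrite /I upto0.
    by move=> r; rewrite !inE negb_or /= /update => /andP[/negPf-> /negPf->].
  move=> s1 [ag1 I0]; have env1 := env_agree ag1 isT env_s.
  have [s11 s12 s13 s14 [s15 s16]] := env1.
  apply: (@ok_for _ _ _ _ _ n I) => //.
  - by move=> i t t' [tm t18 t19] t'm ag; split; rewrite ?t'm ?ag.
  - move=> i t lt_i t22 ag [tm t18 t19]; have envt := env_agree ag isT env1.
    have mt : memok A t.2 by rewrite tm.
    have [t15 t16 t17] : [/\ t.1 15 = s.1 15, t.1 16 = s.1 16 & t.1 17 = s.1 17].
      by split; rewrite ag // ag1.
    apply: ok_seq; first by apply/ok_frame/(iny_ok _ _ envt mt); rewrite ?t22.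
    move=> t1 [[t1m t112] ag']; rewrite t22 t15 in t112.
    have env1' := env_agree ag' isT envt; have mt1 : memok A t1.2 by rewrite t1m.
    have t122 : t1.1 22 = i by rewrite ag'.
    have [t116 t117] : t1.1 16 = s.1 16 /\ t1.1 17 = s.1 17 by rewrite !ag'.
    have [t118 t119] : t1.1 18 = t.1 18 /\ t1.1 19 = t.1 19 by rewrite !ag'.
    apply: ok_if => [nz|z]; last first.
      by apply: ok_blk; rewrite /I /= t1m t118 t119 foldl_uptoS {1 3}/f /pick_step
        -t112 z.
    apply: ok_seq; first by apply/ok_frame/(value_ok env1' mt1); rewrite t122.
    move=> t2 [[t2m t227] ag'']; rewrite t122 t116 t117 in t227.
    have [t218 t219] : t2.1 18 = t.1 18 /\ t2.1 19 = t.1 19 by rewrite !ag''.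
    have t222 : t2.1 22 = i by rewrite ag''.
    apply: (@ok_seq _ _ _ _ _ (fun t3 => [/\ agree [:: 31] t2 t3, t3.2 = t2.2 & t3.1
      31 = t2.1 27 - t2.1 19])).
      by apply: ok_blk; split=> //= r; rewrite inE /= /update => /negPf->.
    move=> t3 [ag3 t3m t331].
    have [t318 t319] : t3.1 18 = t.1 18 /\ t3.1 19 = t.1 19 by rewrite !ag3.
    have [t322 t327] : t3.1 22 = i /\ t3.1 27 = t2.1 27 by rewrite !ag3.
    have lt_val : (t3.1 31 != 0) = (t.1 19 < value A (s.1 16) (s.1 17) i).
      by rewrite t331 t227 t219 -lt0n subn_gt0.
    have fE : foldl f (0, 0) (upto i.+1) =
        if t3.1 31 != 0 then (i, t2.1 27) else foldl f (0, 0) (upto i).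
      by rewrite foldl_uptoS [LHS]/f /pick_step -t112 nz -t19 -lt_val t227.
    apply: ok_if => nz'; apply: ok_blk; rewrite /I fE nz' /= ?/update /= t3m t2m t1m tm.
      by rewrite t322 t327.
    by rewrite t318 t319.
  by move=> t ag [].
rewrite /= ?maxn0; nia.
Qed.

Lemma pick_nat_lt A j l x : 0 < n -> pick_nat A j l x < n.
Proof.
move=> n_gt0; rewrite /pick_nat.
have: all (fun v => v < n) (upto n) by rewrite uptoE; apply/allP=> v; rewrite mem_iota.
have: (0, 0).1 < n by [].
elim: (upto n) (0, 0) => //= v vs IHvs zb lt_zb /andP[lt_v lt_vs].
by apply: IHvs => //; rewrite /pick_step; case: ifP.
Qed.

Lemma filter_ok A s : env s.1 -> memok A s.2 -> (0 < n -> s.1 18 < n) ->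
  ok FILTER s (n * (8 * n + 40) + 3)
    (fun s' => memok (filt A (s.1 20) (s.1 21 != 0) (s.1 18)) s'.2).
Proof.
move=> env_s ms lt_z; set F := filt _ _ _ _.
have [s1 s2 s3 s4 [s5 s6]] := env_s.
(* After [i] rounds the entries below [i] are final. Updating in place is safe because [filt]
   consults [A] only at the entry being treated. *)
pose mix i w := if w < i then F w else A w.
have mixS i w : mix i.+1 w = if w == i then F w else mix i w.
  by rewrite /mix ltnS; case: ltngtP.
have mixi i : mix i i = A i by rewrite /mix ltnn.
eapply ok_le.
  apply: (@ok_for _ _ _ _ _ n (fun i t => memok (mix i) t.2)) => //.
  - by move=> i t t' mt ->.
  - move=> i t lt_i t22 ag mt; have envt := env_agree ag isT env_s.
    have [t18 t20 t21] : [/\ t.1 18 = s.1 18, t.1 20 = s.1 20 & t.1 21 = s.1 21].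
      by split; rewrite ag.
    have lt_z' : s.1 18 < n by apply: lt_z; lia.
    have keep0 (t' : store) : F i = A i -> t'.2 = t.2 -> memok (mix i.+1) t'.2.
      move=> Fi ->; case: mt => inpt at'; split=> // v lt_v; rewrite at' // mixS.
      by case: eqP => // ->; rewrite Fi mixi.
    have kill0 (t' : store) : F i = false -> t'.1 6 = AL -> t'.1 22 = i -> t'.2 = t.2 ->
        ok KILL t' 3 (fun t'' => memok (mix i.+1) t''.2).
      move=> Fi t'6 t'22 t'm; case: mt => inpt at'; apply: ok_blk; rewrite /= /update
        /= t'6 t'22 t'm.
      split=> [b lt_b|v lt_v]; first by rewrite ltn_eqF ?inpt // ltn_addr.
      by rewrite eqn_add2l mixS; case: eqP => [->|_]; rewrite ?Fi ?at'.
    apply: ok_seq; first by apply/ok_frame/(iny_ok _ _ envt mt); rewrite ?t22.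
    move=> t1 [[t1m t112] ag']; rewrite t22 t20 /inY mixi -/(inY A _ _) in t112.
    have env1' := env_agree ag' isT envt; have mt1 : memok (mix i) t1.2 by rewrite t1m.
    have t122 : t1.1 22 = i by rewrite ag'.
    have t118 : t1.1 18 = s.1 18 by rewrite ag'.
    have t121 : t1.1 21 = s.1 21 by rewrite ag'.
    have FE : F i = A i && ~~ ((t1.1 12 != 0) && (ad i (s.1 18) != (s.1 21 != 0))).
      by rewrite /F /filt -t112.
    apply: ok_if => [nz|z]; last first.
      by apply: ok_blk; apply: keep0 => //; rewrite FE z andbT.
    apply: ok_seq; first by apply/ok_frame/(adj_ok _ _ env1' mt1); rewrite ?t122 ?t118.
    move=> t2 [[t2m t212] ag'']; rewrite t122 t118 in t212.
    have [_ _ _ _ [_ t26]] := env_agree ag'' isT env1'.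
    have t222 : t2.1 22 = i by rewrite ag''.
    have t221 : t2.1 21 = s.1 21 by rewrite ag''.
    rewrite nz -t212 -t221 /= in FE; rewrite t1m in t2m.
    by apply: ok_if => z1; apply: ok_if => z2;
      (try by apply: ok_blk; apply: keep0; rewrite // FE z1 z2 andbT);
      (try by apply: kill0; rewrite // FE z1 z2 andbF).
  - by move=> t ag [inpt at']; split=> // v lt_v; rewrite at' // /mix lt_v.
rewrite /= ?maxn0 ?max0n; nia.
Qed.

(** [U] bounds the current word, which enters because extracting a digit is linear in its value. *)
Definition op_time (U : nat) : nat :=
  3 * (6 * U + 6) + (n * (n * (8 * n + 32) + 4 * n + 40) + 5)
  + (k * (6 * U + n * (8 * n + 40) + 13) + 3).

Lemma filt_steps_le z WA l : (foldl (filt_step z) WA l).1 <= WA.1.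
Proof.
elim: l WA => //= i l IHl WA; apply: leq_trans (IHl _) _; exact: leq_div.
Qed.

Lemma op_ok A s W U : env s.1 -> memok A s.2 -> s.1 9 = W -> W <= U ->
  ok OP s (op_time U) (fun s' => s'.1 9 = (op_nat W A).1 /\ memok (op_nat W A).2 s'.2).
Proof.
move=> env_s ms s9 le_W.
have digit r t W' : r \notin [:: 3; 4; 9; 13; 14] -> env t.1 -> t.1 9 = W' -> W' <= U ->
    ok (DIGIT r) t (6 * U + 6)
      (fun t' => [/\ t'.2 = t.2, t'.1 r = W' %% B & t'.1 9 = W' %/ B] /\ agree
        (writes (DIGIT r)) t t').
  by move=> rN envt t9 le_W'; apply: ok_le (ok_frame (digit_ok rN envt t9)) _; lia.
have [le_W1 le_W2 le_W3] : [/\ W %/ B <= U, W %/ B %/ B <= U & W %/ B %/ B %/ B <= U].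
  by split; do ?[apply: leq_trans (leq_div _ _) _].
set z := pick_nat A (W %% B) (W %/ B %% B) (W %/ B %/ B %% B).
pose f := filt_step z; pose WA i := foldl f (W %/ B %/ B %/ B, A) (upto i).
eapply ok_le.
  apply: ok_seq; first exact: (digit 15 s W).
  move=> s1 [[s1m s115 s19] ag1]; have env1 := env_agree ag1 isT env_s.
  apply: ok_seq; first exact: (digit 16 s1 (W %/ B)).
  move=> s2 [[s2m s216 s29] ag2]; have env2 := env_agree ag2 isT env1.
  apply: ok_seq; first exact: (digit 17 s2 (W %/ B %/ B)).
  move=> s3 [[s3m s317 s39] ag3]; have env3 := env_agree ag3 isT env2.
  have m3 : memok A s3.2 by rewrite s3m s2m s1m.
  apply: ok_seq; first exact/ok_frame/(pick_ok env3 m3).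
  move=> s4 [[s4m s418] ag4]; have env4 := env_agree ag4 isT env3.
  have {}s418 : s4.1 18 = z.
    by rewrite s418 s317 ag3 // ag3 // s216 ag2 // s115.
  have s49 : s4.1 9 = W %/ B %/ B %/ B by rewrite ag4.
  have [_ s42 _ s44 _] := env4.
  apply: (@ok_for _ _ _ _ _ k (fun i t => t.1 9 = (WA i).1 /\ memok (WA i).2 t.2)) =>
    //.
  - by move=> i t t' [t9 mt] -> ag; rewrite ag.
  - by rewrite /WA upto0 /= s4m s49.
  move=> i t lt_i t20 ag [t9 mt]; have envt := env_agree ag isT env4.
  have le_WA : (WA i).1 <= U := leq_trans (filt_steps_le z (_, A) (upto i)) le_W3.
  apply: ok_seq; first exact: (digit 21 t (WA i).1).
  move=> t1 [[t1m t121 t19] ag']; have env1' := env_agree ag' isT envt.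
  have t118 : t1.1 18 = z by rewrite ag' // ag.
  have t120 : t1.1 20 = i by rewrite ag'.
  have mt1 : memok (WA i).2 t1.2 by rewrite t1m.
  have := filter_ok env1' mt1; rewrite t118 t120 t121 => /(_ (@pick_nat_lt _ _ _
    _))/ok_frame okf.
  apply: ok_weaken okf (leqnn _) _ => t2 [mt2 ag''].
  by rewrite /WA foldl_uptoS -/(WA i) /=; split; first by rewrite ag''.
rewrite /op_time /=; nia.
Qed.

Lemma reset_ok s : env s.1 -> inp s.2 ->
  ok RESET s (n * 6 + 3) (fun s' => memok predT s'.2).
Proof.
move=> env_s inps; have [s1 _ _ s4 [_ s6]] := env_s.
eapply ok_le.
  apply: (@ok_for _ _ _ _ _ n (fun i t => inp t.2 /\ forall v, v < i -> t.2 (AL + v)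
    = 1)) => //.
  - by move=> i t t' mt ->.
  - move=> i t lt_i t22 ag [inpt at']; have [_ _ _ t4 [_ t6]] := env_agree ag isT env_s.
    apply: ok_blk; rewrite /= /update /= t6 t4 t22; split=> [b lt_b|v lt_v].
      by rewrite ltn_eqF ?inpt // ltn_addr.
    by rewrite eqn_add2l; case: eqP => // /eqP vi; apply: at'; rewrite ltn_neqAle vi.
rewrite /=; lia.
Qed.

Lemma op_nat_lt W A : B <= W -> (op_nat W A).1 < W.
Proof.
move=> le_W; apply: leq_ltn_trans (filt_steps_le _ _ _) _ => /=.
apply: leq_ltn_trans (leq_div _ _) _; apply: leq_ltn_trans (leq_div _ _) _.
by apply: ltn_Pdiv; rewrite /B in le_W *; lia.
Qed.

Lemma word_ok s W U : env s.1 -> inp s.2 -> s.1 9 = W -> W <= U ->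
  ok WORD s (n * 6 + U * (op_time U + 4) + 6)
    (fun s' => exists2 A, decodes W predT A & memok A s'.2).
Proof.
move=> env_s inps s9 le_W.
(* Whatever the remaining word [m] decodes to from the current set is what [W] decodes to from the
   full set. *)
pose I m t := [/\ t.1 9 = m, t.1 29 = m + 1 - B, m <= U &
  exists2 A, (forall A', decodes m A A' -> decodes W predT A') & memok A t.2].
eapply ok_le.
  apply: ok_seq; first exact/ok_frame/(reset_ok env_s inps).
  move=> s1 [m1 ag1]; have env1 := env_agree ag1 isT env_s.
  apply: (@ok_seq _ _ _ _ _ (fun t => env t.1 /\ I W t)).
    have [s11 s12 s13 s14 s15] := env1; have s19 : s1.1 9 = W by rewrite ag1.
    apply: ok_blk; rewrite /I /env /= /update /= s13 s14 s19.
    by split=> //; split=> //; exists predT.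
  move=> s2 [env2 I2]; apply: ok_while I2 _ _ => m t ag [t9 t29 le_m [A decA mA]];
    last first.
    by rewrite t29 => z; exists A => //; apply: decA; constructor; lia.
  have envt := env_agree ag isT env2; rewrite t29 => nz; have le_B : B <= m by lia.
  apply: ok_seq; first exact/ok_frame/(op_ok envt mA t9 le_m).
  move=> t1 [[t19 mt1] ag']; have [_ _ t13 t14 _] := env_agree ag' isT envt.
  apply: ok_blk; exists (op_nat m A).1; first exact: op_nat_lt.
  rewrite /I /= /update /= t13 t14 t19; split=> //.
    by apply: leq_trans le_m; apply/ltnW/op_nat_lt.
  by exists (op_nat m A).2 => // A' dec; apply/decA/(DecCons le_B).
rewrite /=; have := leq_mul le_W (leqnn (op_time U + 4)); lia.
Qed.

Lemma check_ok A s : env s.1 -> memok A s.2 ->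
  ok CHECK s (n * (n * (4 * n + 20) + 20) + 20)
    (fun s' => [/\ s'.2 = s.2, s'.1 10 = if success A then 1 else s.1 10
       & s'.1 8 = if success A then 0 else s.1 8]).
Proof.
move=> env_s ms.
pose Pv u v := A v ==> ~~ ad u v; pose Pu u := A u ==> all (Pv u) (upto n).
pose I i t := [/\ t.2 = s.2, t.1 32 = count A (upto i) & (t.1 30 != 0) = all Pu (upto
  i)].
have all_uptoS P i : all P (upto i.+1) = all P (upto i) && P i.
  by rewrite uptoS all_rcons andbC.
have alive t v : v \notin [:: 12] -> env t.1 -> t.2 = s.2 -> t.1 v < n ->
    ok (ALIVE v) t 2 (fun t' => [/\ t'.2 = s.2, (t'.1 12 != 0) = A (t.1 v) & agree
      [:: 12] t t']).
  rewrite inE => v12 [_ _ _ _ [_ t6]] tm lt_v; apply: ok_blk; rewrite /= /update /=.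
  split=> //; last by move=> r; rewrite inE /= /update => /negPf r12; rewrite !r12.
  by case: ms => _ ms; rewrite t6 tm ms //; case: (A _).
eapply ok_le.
  apply: (@ok_seq _ _ _ _ _ (fun s1 => agree [:: 32; 30] s s1 /\ I 0 s1)).
    apply: ok_blk; split; last by rewrite /I upto0.
    by move=> r; rewrite !inE negb_or /= /update => /andP[/negPf-> /negPf->].
  move=> s1 [ag1 I0]; have env1 := env_agree ag1 isT env_s.
  have [s11 s12 s13 s14 [s15 s16]] := env1.
  apply: (@ok_seq _ _ _ _ _ (fun t => [/\ I n t, env t.1, t.1 10 = s.1 10 & t.1 8 =
    s.1 8])).
    apply: (@ok_for _ _ _ _ _ n I) => //.
    - by move=> i t t' [tm t32 t30] t'm ag; split; rewrite ?t'm ?ag.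
    - move=> i t lt_i t22 ag [tm t32 t30]; have envt := env_agree ag isT env1.
      apply: ok_seq; first by apply: (@alive t 22); rewrite ?t22.
      move=> t1 [t1m t112 ag']; rewrite t22 in t112.
      have env1' := env_agree ag' isT envt.
      have [t132 t130] : t1.1 32 = t.1 32 /\ t1.1 30 = t.1 30 by rewrite !ag'.
      apply: ok_if => [nz|z]; last first.
        apply: ok_blk; rewrite /I /= t1m t132 t130 count_uptoS all_uptoS [Pu i]/Pu
          -t112 z.
        by rewrite addn0 andbT.
      apply: (@ok_seq _ _ _ _ _ (fun t2 => [/\ agree [:: 32] t1 t2, t2.2 = s.2 & t2.1
        32 = count A (upto i.+1)])).
        apply: ok_blk; rewrite /= /update /= count_uptoS -t112 nz t132 t32; split=> //.
          by move=> r; rewrite inE /= /update => /negPf->.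
        by case: env1' => _ _ _ ->.
      move=> t2 [ag2 t2m t232]; have env2 := env_agree ag2 isT env1'.
      have [t21 _ _ t24 _] := env2.
      have t222 : t2.1 22 = i by rewrite ag2 // ag'.
      have t230 : (t2.1 30 != 0) = all Pu (upto i) by rewrite ag2 // t130.
      apply: (@ok_for _ _ _ _ _ n (fun j t3 => [/\ t3.2 = s.2, t3.1 32 = count A
        (upto i.+1)
          & (t3.1 30 != 0) = all Pu (upto i) && all (Pv i) (upto j)])) => //.
      + by move=> j t3 t4 [t3m t332 t330] t4m ag4; split; rewrite ?t4m ?ag4.
      + by rewrite upto0 andbT.
      + move=> j t3 lt_j t324 ag3 [t3m t332 t330]; have env3 := env_agree ag3 isT env2.
        apply: ok_seq; first by apply: (@alive t3 24); rewrite ?t324.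
        move=> t4 [t4m t412 ag4]; rewrite t324 in t412; have env4 := env_agree ag4
          isT env3.
        have [t432 t430] : t4.1 32 = t3.1 32 /\ t4.1 30 = t3.1 30 by rewrite !ag4.
        apply: ok_if => [nz4|z4]; last first.
          apply: ok_blk; rewrite /= t4m t432 t430 all_uptoS [Pv i j]/Pv -t412 z4.
          by rewrite !andbT.
        have t422 : t4.1 22 = i by rewrite ag4 // ag3.
        have t424 : t4.1 24 = j by rewrite ag4.
        have m4 : memok A t4.2 by rewrite t4m.
        apply: ok_seq; first by apply/ok_frame/(adj_ok _ _ env4 m4); rewrite ?t422
          ?t424.
        move=> t5 [[t5m t512] ag5]; rewrite t422 t424 in t512.
        have [t532 t530] : t5.1 32 = t3.1 32 /\ t5.1 30 = t3.1 30 by rewrite !ag5.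
        have PvE : Pv i j = ~~ ad i j by rewrite /Pv -t412 nz4.
        apply: ok_if => [nz5|z5]; apply: ok_blk; rewrite /= ?/update /= t5m t4m t532;
          split=> //.
          by rewrite all_uptoS PvE -t512 nz5 !andbF.
        by rewrite t530 t330 all_uptoS PvE -t512 z5 /= andbT.
      + by move=> t3 ag3 [t3m t332 t330]; split=> //; rewrite t330 all_uptoS [Pu
        i]/Pu -t112 nz.
    - by move=> t ag It; split=> //; [exact: env_agree ag isT env1 | rewrite ag //
      ag1 | rewrite ag // ag1].
  move=> t [[tm t32 t30] envt t10 t8]; have [_ t2 _ _ _] := envt.
  apply: (@ok_seq _ _ _ _ _ (fun t1 => [/\ agree [:: 31; 12] t t1, t1.2 = s.2 & (t1.1
    31 == 0) = (count A (upto n) == k)])).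
    apply: ok_blk; rewrite /= /update /= t32 t2; split=> //.
      by move=> r; rewrite !inE negb_or /= /update => /andP[/negPf r31 /negPf r12];
        rewrite !(r31, r12).
    by rewrite addn_eq0 !subn_eq0 eqn_leq.
  move=> t1 [ag' t1m t131].
  have [t110 t18] : t1.1 10 = s.1 10 /\ t1.1 8 = s.1 8 by rewrite !ag'.
  have t130 : t1.1 30 = t.1 30 by rewrite ag'.
  rewrite /success -t131 -[all _ _]/(all Pu (upto n)) -t30 -t130.
  apply: ok_if => [nz|z]; first by apply: ok_blk; rewrite /= (negPf nz).
  by apply: ok_if => z'; apply: ok_blk; rewrite /= ?/update /= z z'.
rewrite /= ?maxn0 ?max0n; nia.
Qed.

(** The output overwrites the input, but at most its addresses [0] to [n], which lie below the
    vector of survivors at [AL]. *)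
Lemma output_ok A s : env s.1 -> memok A s.2 ->
  ok OUTPUT s (n * 10 + 6) (fun s' => mkseq s'.2 (s'.1 0) = 1 :: filter A (upto n)).
Proof.
move=> env_s [_ alive_s].
pose o i := 1 :: filter A (upto i).
pose I i t := [/\ t.1 0 = size (o i), forall j, j < size (o i) -> t.2 j = nth 0 (o i) j
  & forall v, v < n -> t.2 (AL + v) = A v].
have size_o i : size (o i) <= i.+1.
  by rewrite /= ltnS size_filter (leq_trans (count_size _ _)) // uptoE size_iota.
eapply ok_le.
  apply: (@ok_seq _ _ _ _ _ (fun s1 => agree [:: 12; 0] s s1 /\ I 0 s1)).
    apply: ok_blk; split.
      by move=> r; rewrite !inE negb_or /= /update => /andP[/negPf-> /negPf->].
    have [_ _ _ s4 _] := env_s.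
    rewrite /I /o upto0 /= /update /= s4; split; [by [] | by case | move=> v lt_v].
    by rewrite alive_s.
  move=> s1 [ag1 I0]; have env1 := env_agree ag1 isT env_s.
  have [s11 s12 s13 s14 [s15 s16]] := env1.
  apply: (@ok_for _ _ _ _ _ n I) => //.
  - by move=> i t t' [t0 tm alive_t] t'm ag; split; rewrite ?t'm ?ag.
  - move=> i t lt_i t22 ag [t0 tm alive_t]; have envt := env_agree ag isT env1.
    have [_ _ _ t4 [_ t6]] := envt.
    apply: (@ok_seq _ _ _ _ _ (fun t1 => [/\ agree [:: 12] t t1, t1.2 = t.2 & t1.1 12
      = A i])).
      apply: ok_blk; split=> //; first by move=> r; rewrite inE /= /update => /negPf
        rN; rewrite !rN.
      by rewrite /= /update /= t6 t22 alive_t.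
    move=> t1 [ag' t1m t112].
    have [t10 t122 t14] : [/\ t1.1 0 = size (o i), t1.1 22 = i & t1.1 4 = 1].
      by split; rewrite ag'.
    have oS : o i.+1 = if A i then rcons (o i) i else o i.
      by rewrite /o uptoS filter_rcons; case: ifP.
    apply: ok_if => nz; apply: ok_blk; rewrite t112 in nz; last first.
      by rewrite /I oS; case: (A i) nz => //= _; rewrite t10 t1m; split.
    have {nz}Ai : A i by case: (A i) nz.
    rewrite /I oS Ai size_rcons; move: (o i) (size_o i) tm t10 => oi size_oi tm t10.
    rewrite /= /update /= t10 t122 t14 t1m; split.
    + by rewrite addn1.
    + move=> j; rewrite ltnS nth_rcons leq_eqVlt => /predU1P[->|lt_j]; first by
      rewrite eqxx ltnn.
      by rewrite lt_j ltn_eqF // tm.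
    + move=> v lt_v; rewrite gtn_eqF ?alive_t //.
      by apply: leq_ltn_trans size_oi _; rewrite /AL; nia.
  - move=> t ag [t0 tm alive_t]; rewrite t0; apply: (@eq_from_nth _ 0); rewrite
    size_mkseq //.
    by move=> j lt_j; rewrite nth_mkseq // tm.
rewrite /= ?maxn0; lia.
Qed.

(** * The number of words tried and the total running time *)

Definition budget : nat := 2 ^ ((k + 3) ^ 8).

Definition init_time : nat :=
  8 * n + 4 * (k + 3) + 4 * (k + 3) ^ 2 + 4 * (k + 3) ^ 4 + 4 * (k + 3) ^ 8 + 30.

Lemma init_ok s : (forall r, s.1 r = 0) -> s.2 = M0 -> M0 0 = n -> M0 1 = k ->
  ok INIT s init_time (fun s' => [/\ env s'.1, s'.2 = M0, s'.1 8 = budget & s'.1 10 =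
    0]).
Proof.
move=> s_r sm Mn Mk.
suff okI : ok INIT s init_time (fun t => [/\ env t.1, t.2 = M0 & t.1 8 = budget]).
  by apply: ok_weaken (ok_frame okI) (leqnn _) _ => t [[envt tm t8] ag]; split=> //;
    rewrite ag.
eapply ok_le.
  apply: (@ok_seq _ _ _ _ _ (fun s1 => [/\ s1.1 1 = n, s1.1 2 = k, s1.1 3 = B, s1.1 4
    = 1 & s1.1 33 = k + 3 /\ s1.2 = M0])).
    by apply: ok_blk; rewrite /= /update /= s_r sm Mn Mk /B -!addnA.
  move=> s1 [s11 s12 s13 s14 [s133 s1m]].
  apply: ok_seq; first exact/ok_frame/(mul_ok (N := n)).
  move=> s2 [[s25 s2m] ag2].
  apply: (@ok_seq _ _ _ _ _ (fun t => [/\ agree [:: 5] s2 t, t.1 5 = 2 + n * n & t.2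
    = M0])).
    apply: ok_blk; split; first by move=> r; rewrite inE /= /update => /negPf rN;
      rewrite !rN.
      by rewrite /= /update /= s25 s11 !ag2 // s14; lia.
    by rewrite /= s2m.
  move=> s3 [ag3 s35 s3m].
  apply: ok_seq; first apply/ok_frame/(mul_ok (N := n)); rewrite // ?ag3 // ?ag2 //.
  move=> s4 [[s46 s4m] ag4].
  have {}s46 : s4.1 6 = k * n by rewrite s46 s12.
  apply: (@ok_seq _ _ _ _ _ (fun t => [/\ agree [:: 6] s4 t, t.1 6 = AL & t.2 = M0])).
    apply: ok_blk; split; first by move=> r; rewrite inE /= /update => /negPf rN;
      rewrite !rN.
      by rewrite /= /update /= s46 ag4 // s35 /AL; lia.
    by rewrite /= s4m.
  move=> s5 [ag5 s56 s5m].
  have env5 : env s5.1.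
    by split; first [by rewrite ag5 // ag4 // ag3 // ag2 | split=> //; rewrite ag5 //
      ag4].
  have s533 : s5.1 33 = k + 3 by rewrite ag5 // ag4 // ag3 // ag2.
  have [_ _ _ s54 _] := env5.
  apply: ok_seq; first exact/ok_frame/(mul_ok (N := k + 3)).
  move=> s6 [[s634 s6m] ag6]; have s64 : s6.1 4 = 1 by rewrite ag6.
  have {}s634 : s6.1 34 = (k + 3) ^ 2 by rewrite s634 s533.
  apply: ok_seq; first exact/ok_frame/(mul_ok (N := (k + 3) ^ 2)).
  move=> s7 [[s735 s7m] ag7]; have s74 : s7.1 4 = 1 by rewrite ag7.
  have {}s735 : s7.1 35 = (k + 3) ^ 4 by rewrite s735 s634 -expnD.
  apply: ok_seq; first exact/ok_frame/(mul_ok (N := (k + 3) ^ 4)).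
  move=> s8 [[s836 s8m] ag8]; have s84 : s8.1 4 = 1 by rewrite ag8.
  have {}s836 : s8.1 36 = (k + 3) ^ 8 by rewrite s836 s735 -expnD.
  have env8 : env s8.1.
    exact/(env_agree ag8 isT)/(env_agree ag7 isT)/(env_agree ag6 isT).
  pose I m (t : store) := [/\ t.1 36 = m, t.1 8 * 2 ^ m = budget & t.2 = M0].
  apply: (@ok_seq _ _ _ _ _ (fun t => [/\ agree [:: 8] s8 t & I ((k + 3) ^ 8) t])).
    apply: ok_blk; split; first by move=> r; rewrite inE /= /update => /negPf->.
    by rewrite /I /= /update /= s836 s8m s7m s6m s5m mul1n.
  move=> s9 [ag9 I9]; have env9 := env_agree ag9 isT env8.
  apply: ok_while I9 _ _ => m t ag [t36 t8 tm] nz; have envt := env_agree ag isT env9.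
    have [_ _ _ t4 _] := envt; apply: ok_blk; exists m.-1; first by rewrite -t36
      prednK // lt0n.
    rewrite /I /= /update /= t36 t4 subn1; split=> //.
    by rewrite addnn -muln2 -mulnA -expnS prednK // -t36 lt0n.
  by split=> //; rewrite -t8 -t36 nz muln1.
rewrite /init_time /=; lia.
Qed.

Definition body_time : nat :=
  (n * 6 + budget * (op_time budget + 4) + 6) + (n * (n * (4 * n + 20) + 20) + 20) + 2.

Definition main_time : nat :=
  init_time + (budget * (body_time + 2) + 1) + (n * 10 + 8).

Lemma main_ok s : (forall r, s.1 r = 0) -> s.2 = M0 -> M0 0 = n -> M0 1 = k ->
  ok MAIN s main_time (fun s' => let out := mkseq s'.2 (s'.1 0) in
    (exists2 A, success A & out = 1 :: filter A (upto n)) \/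
    (out = [:: 0] /\ forall W, W < budget -> exists2 A, decodes W predT A & ~~
      success A)).
Proof.
move=> s_r sm Mn Mk.
(* Either all words from [m] up to the budget have failed, or a success has just forced [m = 0]. *)
pose I m t := [/\ t.1 8 = m, m <= budget, inp t.2 &
  (t.1 10 = 0 /\ forall W, m <= W < budget -> exists2 A, decodes W predT A & ~~
    success A) \/
  [/\ t.1 10 = 1, m = 0 & exists2 A, memok A t.2 & success A]].
eapply ok_le.
  apply: ok_seq; first exact: init_ok s_r sm Mn Mk.
  move=> s1 [env1 s1m s18 s110].
  have I1 : I budget s1.
    by split=> //; [rewrite s1m | left; split=> // W; case: ltngtP].
  apply: (@ok_seq _ _ _ _ _ (fun t => env t.1 /\ I 0 t)); last first.
    move=> t [envt [t8 _ inpt [[t10 none]|[t10 _ [A mA sA]]]]]; apply: ok_if => z.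
    - by rewrite t10 in z.
    - by apply: ok_blk; right.
    - by apply: ok_weaken (output_ok envt mA) (leqnn _) _ => t' outE; left; exists A.
    - by rewrite t10 in z.
  apply: ok_while I1 _ _ => m t ag [t8 le_m inpt It] nz; have envt := env_agree ag
    isT env1; last first.
    by rewrite t8 in nz; rewrite nz in t8 It *; split.
  case: It => [[t10 none]|[_ m0 _]]; last by rewrite t8 m0 in nz.
  have [_ _ _ t4 _] := envt; have m_gt0 : 0 < m by rewrite lt0n -t8.
  apply: (@ok_seq _ _ _ _ _ (fun t1 => [/\ agree [:: 8; 9] t t1, t1.1 8 = m.-1, t1.1
    9 = m.-1 & t1.2 = t.2])).
    apply: ok_blk; split=> //=; rewrite /update /= ?t8 ?t4 ?subn1 //.
    by move=> r; rewrite !inE negb_or /= /update => /andP[/negPf-> /negPf->].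
  move=> t1 [ag1 t18 t19 t1m]; have env1' := env_agree ag1 isT envt.
  have inp1 : inp t1.2 by rewrite t1m.
  have le_m' : m.-1 <= budget by rewrite (leq_trans (leq_pred _)).
  apply: ok_seq; first exact/ok_frame/(word_ok env1' inp1 t19 le_m').
  move=> t2 [[A decA mA] ag2]; have env2 := env_agree ag2 isT env1'.
  apply: ok_weaken (check_ok env2 mA) (leqnn _) _ => t3 [t3m t310 t38].
  have inp3 : inp t3.2 by rewrite t3m; case: mA.
  case: ifP t310 t38 => sA t310 t38.
    by exists 0 => //; split=> //; right; split=> //; exists A; rewrite ?t3m.
  exists m.-1; first by rewrite prednK.
  split=> //; first by rewrite t38 ag2.
  left; split; first by rewrite t310 ag2 // ag1.
  move=> W; rewrite leq_eqVlt => /andP[/predU1P[<- _|lt_W lt_b]]; first by exists A;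
    rewrite ?sA.
  by apply: none; rewrite lt_b andbT -(prednK m_gt0).
rewrite /main_time /body_time /=; lia.
Qed.

(** One operation costs order [K ^ 2 * q]. A word below the budget undergoes at most [budget]
    operations, and there are at most [budget] words; each of these two loops adds a factor [K]. *)
Lemma main_time_le : 0 < n -> main_time <= 500 * ((budget + k + 3) ^ 4 * n ^ 3).
Proof.
move=> n_gt0; set K := budget + k + 3; set q := n ^ 3.
have [b_K k_K K_gt0] : [/\ budget <= K, k <= K & 0 < K] by rewrite /K; split; lia.
have q_gt0 : 0 < q by rewrite expn_gt0 n_gt0.
have n_q : n <= q by rewrite -[X in X <= _]expn1 leq_pexp2l.
have n2_q : n * n <= q by rewrite mulnn leq_pexp2l.
have n3_q : n * (n * n) = q by rewrite mulnn -expnS.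
have pow_K e : e <= 8 -> (k + 3) ^ e <= K.
  move=> le_e; apply: leq_trans b_K; apply: leq_trans (_ : (k + 3) ^ 8 <= _).
    by rewrite leq_pexp2l // addn3.
  by apply: ltnW; rewrite /budget ltn_expl.
have [p1 p2 p4 p8] : [/\ k + 3 <= K, (k + 3) ^ 2 <= K, (k + 3) ^ 4 <= K & (k + 3) ^ 8
  <= K].
  by split; [rewrite -[X in X <= _]expn1 pow_K | exact: pow_K..].
have mono a b c d : a <= c -> b <= d -> K ^ a * q ^ b <= K ^ c * q ^ d.
  by move=> ac bd; rewrite leq_mul // leq_pexp2l.
have opt : op_time budget <= 200 * (K ^ 2 * q).
  have := mono 0 0 2 1 isT isT; have := mono 1 0 2 1 isT isT.
  have := mono 0 1 2 1 isT isT; have := mono 1 1 2 1 isT isT; have := mono 2 0 2 1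
    isT isT.
  rewrite !expn1 !expn0 !mul1n !muln1 => h1 h2 h3 h4 h5.
  have t1 : k * (6 * budget + n * (8 * n + 40) + 13) <= K * (6 * K + 48 * q + 13).
    by apply: leq_mul => //; nia.
  have t2 : K * (6 * K + 48 * q + 13) = 6 * K ^ 2 + 48 * (K * q) + 13 * K.
    by rewrite -mulnn; lia.
  have t3 : n * (n * (8 * n + 32) + 4 * n + 40) <= 84 * q.
    by rewrite (_ : _ + 40 = 8 * (n * n) + 36 * n + 40) ?mulnDr; lia.
  rewrite /op_time; lia.
have bodyt : body_time + 2 <= 300 * (K ^ 3 * q).
  have := mono 0 0 3 1 isT isT; have := mono 1 0 3 1 isT isT; have := mono 0 1 3 1
    isT isT.
  rewrite !expn1 !expn0 !mul1n !muln1 => h1 h2 h3.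
  have t1 : budget * (op_time budget + 4) <= K * (200 * (K ^ 2 * q) + 4).
    by apply: leq_mul => //; lia.
  have t2 : K * (200 * (K ^ 2 * q) + 4) = 200 * (K ^ 3 * q) + 4 * K.
    by rewrite mulnDr mulnCA [K * (K ^ 2 * q)]mulnA -expnS [K * 4]mulnC.
  have t3 : n * (n * (4 * n + 20) + 20) <= 44 * q.
    by rewrite (_ : _ + 20 = 4 * (n * n) + 20 * n + 20) ?mulnDr; lia.
  rewrite /body_time; lia.
have := mono 0 0 4 1 isT isT; have := mono 1 0 4 1 isT isT; have := mono 0 1 4 1 isT
  isT.
rewrite !expn1 !expn0 !mul1n !muln1 => h1 h2 h3.
have t1 : budget * (body_time + 2) <= K * (300 * (K ^ 3 * q)) by apply: leq_mul.
have t2 : K * (300 * (K ^ 3 * q)) = 300 * (K ^ 4 * q) by rewrite mulnCA [K * (K ^ 3 *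
  q)]mulnA -expnS.
rewrite /main_time /init_time; lia.
Qed.

End Machine.

(** * Correctness on instances *)

Lemma nth_allpairs_row (S T : Type) (f : S -> T -> nat) x0 y0 s t i j :
  i < size s -> j < size t ->
  nth 0 [seq f x y | x <- s, y <- t] (i * size t + j) = f (nth x0 s i) (nth y0 t j).
Proof.
move=> + lt_j; elim: s i => // x s IHs [|i] lt_i; rewrite allpairs_cons nth_cat
  size_map.
  by rewrite lt_j (nth_map y0).
by rewrite mulSn -addnA ltnNge leq_addr /= addKn IHs.
Qed.

(** * The extremal vertex computed by the program *)

Section Picking.

Variables (n k : nat) (M0 : nat -> nat).

Lemma eq_pick_nat A A' j l x : (forall v, v < n -> A v = A' v) ->
  pick_nat n k M0 A j l x = pick_nat n k M0 A' j l x.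
Proof.
move=> eqA; rewrite /pick_nat; congr (_ .1).
have eqY i v : v < n -> inY n k M0 A i v = inY n k M0 A' i v by rewrite /inY => /eqA->.
have eqv v : value n k M0 A l x v = value n k M0 A' l x v.
  rewrite /value; suff -> : cnt n k M0 A l v = cnt n k M0 A' l v by [].
  by apply: eq_in_count => w; rewrite uptoE mem_iota => /eqY->.
have: all (fun v => v < n) (upto n) by rewrite uptoE; apply/allP=> v; rewrite mem_iota.
elim: (upto n) (0, 0) => //= v vs IHvs zb /andP[lt_v /IHvs->].
by rewrite /pick_step eqY // eqv.
Qed.

Lemma pick_nat_spec A j l x v (z := pick_nat n k M0 A j l x) :
  v < n -> inY n k M0 A j v ->
  [/\ z < n, inY n k M0 A j z & value n k M0 A l x v <= value n k M0 A l x z].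
Proof.
rewrite {}/z /pick_nat => lt_v v_j; set f := pick_step _ _ _ _ _ _ _.
have [best zP] : (forall w, w \in upto n -> inY n k M0 A j w ->
      value n k M0 A l x w <= (foldl f (0, 0) (upto n)).2) /\
    let: (z, b) := foldl f (0, 0) (upto n) in
    b = 0 \/ [/\ z \in upto n, inY n k M0 A j z & b = value n k M0 A l x z].
  elim/last_ind: (upto n) => [|vs w [IHb IHz]]; first by split=> //; left.
  rewrite foldl_rcons; case: (foldl f _ vs) IHb IHz => z b /= IHb IHz.
  rewrite /f /pick_step /=; case: ifP => [/andP[w_j lt_b]|w_j] /=.
    split; last by right; rewrite mem_rcons inE eqxx.
    move=> u; rewrite mem_rcons inE => /predU1P[-> //|u_vs u_j].
    exact: leq_trans (IHb _ u_vs u_j) (ltnW lt_b).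
  split; last by case: IHz => [->|[z_vs z_j ->]]; [left|right; rewrite mem_rcons inE
    z_vs orbT].
  move=> u; rewrite mem_rcons inE => /predU1P[->|u_vs] u_j; last exact: IHb.
  by move: w_j; rewrite u_j /= ltnNge => /negbFE.
have v_n : v \in upto n by rewrite uptoE mem_iota.
(* Positivity excludes the initial pair as the result of the scan. *)
have val_gt0 : 0 < value n k M0 A l x v.
  rewrite /value; case: ifP => // _; rewrite subn_gt0 ltnS /cnt.
  by apply: leq_trans (count_size _ _) _; rewrite uptoE size_iota.
have le_v := best v v_n v_j; case: (foldl f _ _) zP le_v => z b /= [->|[z_n z_j ->]]
  le_v.
  by rewrite leqNgt val_gt0 in le_v.
by rewrite uptoE mem_iota in z_n.
Qed.

Lemma cnt_le A l v : cnt n k M0 A l v <= n.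
Proof. by apply: leq_trans (count_size _ _) _; rewrite uptoE size_iota. Qed.

Lemma count_upto_card (P : pred nat) : count P (upto n) = #|[set v : 'I_n | P v]|.
Proof.
rewrite uptoE -sum1_count -sum1_card -[n in iota 0 n]subn0 big_mkord.
by apply: eq_bigl => v; rewrite inE.
Qed.

End Picking.

(** * From numbers in memory to cliques of the instance *)

Section Instance.

Variable I : tisehf_instance.

Let n := nvert I.
Let k := nclq I.
Let e : rel 'I_n := @adj I.
Let X : 'I_k -> {set 'I_n} := @clq I.
Let M0 := nth 0 (tisehf_encoding I).

Lemma X_cover v : exists i, v \in X i.
Proof.
have /and3P[/eqP cov _ _] := clq_partition I.
have := in_setT v; rewrite -cov => /bigcupP[S /imsetP[i _ ->] v_i].
by exists i.
Qed.

Lemma X_disj i j v : v \in X i -> v \in X j -> i = j.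
Proof.
have /and3P[_ /trivIsetP triv _] := clq_partition I.
move=> v_i v_j; apply: (@clq_inj I); apply/eqP/negPn/negP=> ne_ij.
have := triv _ _ (imset_f (@clq I) (isT : i \in 'I_k)) (imset_f (@clq I) (isT : j \in
  'I_k)) ne_ij.
by move/disjointFr/(_ v_i); rewrite -/(X j) v_j.
Qed.

Lemma X_nonempty i : exists v, v \in X i.
Proof.
have /and3P[_ _ nS0] := clq_partition I.
by apply/set0Pn; apply: contraNneq nS0 => <-; apply: imset_f.
Qed.

Lemma X_clique i u v : u \in X i -> v \in X i -> u != v -> e u v.
Proof.
move=> u_i v_i uv; have /forallP/(_ u) := clq_clique i; rewrite -/(X i) u_i.
by move/forallP/(_ v); rewrite -/(X i) v_i uv.
Qed.

Let adj_part : seq nat :=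
  [seq nat_of_bool (adj u v) | u <- enum 'I_(nvert I), v <- enum 'I_(nvert I)].
Let clq_part : seq nat :=
  [seq nat_of_bool (v \in clq i) | i <- enum 'I_(nclq I), v <- enum 'I_(nvert I)].

Lemma size_adj_part : size adj_part = n * n.
Proof. by rewrite size_allpairs size_enum_ord. Qed.

Lemma M0_parts x : M0 (2 + x) = nth 0 (adj_part ++ clq_part) x.
Proof. by []. Qed.

Lemma M0_adj (u v : 'I_n) : M0 (2 + u * n + v) = e u v.
Proof.
have lt_uv : u * n + v < n * n by have := ltn_ord u; have := ltn_ord v; nia.
rewrite -addnA M0_parts nth_cat size_adj_part lt_uv.
have lt_u := ltn_ord u; have lt_v := ltn_ord v.
have := @nth_allpairs_row _ _ (fun u v => nat_of_bool (@adj I u v)) u v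
  (enum 'I_(nvert I)) (enum 'I_(nvert I)) u v.
by rewrite !size_enum_ord !nth_ord_enum => ->.
Qed.

Lemma M0_clq (i : 'I_k) (v : 'I_n) : M0 (2 + n * n + i * n + v) = (v \in X i).
Proof.
rewrite -!addnA M0_parts nth_cat size_adj_part.
rewrite ltnNge leq_addr /= addKn.
have lt_i := ltn_ord i; have lt_v := ltn_ord v.
have := @nth_allpairs_row _ _ (fun i v => nat_of_bool (v \in @clq I i)) i v
  (enum 'I_(nclq I)) (enum 'I_(nvert I)) i v.
by rewrite !size_enum_ord !nth_ord_enum => ->.
Qed.

Lemma adE (u v : 'I_n) : ad n M0 u v = e u v.
Proof. by rewrite /ad M0_adj; case: (e u v). Qed.

Lemma mbE (i : 'I_k) (v : 'I_n) : mb n k M0 i v = (v \in X i).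
Proof. by rewrite /mb ltn_ord M0_clq; case: (v \in X i). Qed.

Definition alive_of (S : {set 'I_n}) : pred nat :=
  fun v => [exists w : 'I_n, (val w == v) && (w \in S)].
Definition set_of (A : pred nat) : {set 'I_n} := [set v | A (val v)].

Lemma alive_ofE S (v : 'I_n) : alive_of S v = (v \in S).
Proof.
apply/existsP/idP => [[w /andP[/eqP/val_inj-> //]]|v_S].
by exists v; rewrite eqxx.
Qed.

Lemma set_ofK A v : v < n -> alive_of (set_of A) v = A v.
Proof. by move=> lt_v; rewrite (alive_ofE _ (Ordinal lt_v)) inE. Qed.

(** A vertex of [X j] witnesses [0 < n], hence [pick_nat] is below [n] and the conversion to ['I_n]
    is exact. *)
Definition pick_ord (S : {set 'I_n}) (j l : 'I_k) (x : bool) : 'I_n :=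
  insubd (xchoose (X_nonempty j)) (pick_nat n k M0 (alive_of S) j l x).

Lemma val_pick_ord S j l x :
  val (pick_ord S j l x) = pick_nat n k M0 (alive_of S) j l x.
Proof.
have [v _] := X_nonempty j; rewrite val_insubd pick_nat_lt //.
exact: leq_ltn_trans (ltn_ord v).
Qed.

Lemma cnt_degree S (l : 'I_k) (v : 'I_n) :
  cnt n k M0 (alive_of S) l v = degree e X S l v.
Proof.
rewrite /cnt count_upto_card; apply: eq_card => w; rewrite !inE.
by rewrite /inY mbE alive_ofE adE [(w \in X l) && _]andbC andbA.
Qed.

Lemma pick_ordP (S : {set 'I_n}) j l x v : v \in S -> v \in X j ->
  [/\ pick_ord S j l x \in S, pick_ord S j l x \in X j
    & if x then degree e X S l v <= degree e X S l (pick_ord S j l x)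
      else degree e X S l (pick_ord S j l x) <= degree e X S l v].
Proof.
move=> v_S v_j; have := val_pick_ord S j l x; set z := pick_ord _ _ _ _ => zE.
have [|_] := @pick_nat_spec n k M0 (alive_of S) j l x v (ltn_ord v).
  by rewrite /inY mbE v_j alive_ofE v_S.
rewrite -zE /inY mbE alive_ofE => /andP[-> ->] le_v; split=> //.
clearbody z; move: le_v; rewrite /value !cnt_degree; case: x {zE} => //= {v_S v_j}.
(* For the minimum, comparisons of [n.+1 - cnt] can be reversed because [cnt] is at most [n]. *)
by have := cnt_le n k M0 (alive_of S) l v; rewrite cnt_degree; lia.
Qed.

(** * Words of operations written as numbers *)

Let keepI := keep e X pick_ord.
Let searchI := search e X pick_ord.
Let B := k + 2.

Definition enc_digits (b : 'I_k -> bool) (W : nat) (ii : seq 'I_k) : nat :=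
  foldr (fun i W => b i + W * B) W ii.

(* The final digit 1 marks the end, lest zero digits be lost. *)
Fixpoint enc (w : seq (op k)) : nat :=
  if w is (j, l, x, b) :: w' then
    j + (l + (x + enc_digits b (enc w') (enum 'I_k) * B) * B) * B
  else 1.

Lemma B_gt1 : 1 < B.
Proof. by rewrite /B addn2. Qed.

Lemma digit_mod d W : d < B -> (d + W * B) %% B = d.
Proof. by move=> lt_d; rewrite addnC modnMDl modn_small. Qed.

Lemma digit_div d W : d < B -> (d + W * B) %/ B = W.
Proof. by move=> lt_d; rewrite addnC divnMDl ?divn_small ?addn0 // /B addn2. Qed.

Lemma ord_B (i : 'I_k) : i < B.
Proof. by rewrite /B ltn_addr. Qed.

Lemma bool_B (b : bool) : b < B.
Proof. by apply: leq_ltn_trans (leq_b1 b) B_gt1. Qed.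

Lemma enc_digits_gt0 b W ii : 0 < W -> 0 < enc_digits b W ii.
Proof.
by move=> W_gt0; elim: ii => //= i ii IHi; rewrite addn_gt0 muln_gt0 IHi (ltnW B_gt1)
  orbT.
Qed.

Lemma enc_gt0 w : 0 < enc w.
Proof.
elim: w => //= -[[[j l] x] b] w IHw.
by do 3 rewrite addn_gt0 muln_gt0 (ltnW B_gt1) andbT; rewrite enc_digits_gt0 ?orbT.
Qed.

Lemma filt_steps_enc z b W A ii :
  exists2 A', foldl (filt_step n k M0 z) (enc_digits b W ii, A) (map val ii) = (W, A')
  & forall v : 'I_n, A' v = A v && all (fun i => (v \in X i) ==> (ad n M0 v z == b
    i)) ii.
Proof.
elim: ii A => [|i ii IHi] A /=; first by exists A => // v; rewrite andbT.
rewrite /filt_step /= digit_div ?bool_B // digit_mod ?bool_B //.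
have [A' -> A'E] := IHi (filt n k M0 A i (nat_of_bool (b i) != 0) z).
exists A' => // v; rewrite A'E /filt /inY mbE -andbA; case: (A v) => //=.
by case: (v \in X i) => //=; rewrite negbK; case: (b i).
Qed.

Lemma op_nat_enc o w A : exists2 A', op_nat n k M0 (enc (o :: w)) A = (enc w, A')
  & set_of A' = keepI (set_of A) o.
Proof.
case: o => -[[j l] x] b; rewrite /op_nat -/B [enc _]/=.
rewrite !(digit_div, digit_mod) ?ord_B ?bool_B // uptoE -val_enum_ord.
have [A' -> A'E] := filt_steps_enc (pick_nat n k M0 A j l x) b (enc w) A (enum 'I_k).
exists A' => //; apply/setP=> v; rewrite !inE A'E; congr (_ && _).
have -> : pick_nat n k M0 A j l x = val (pick_ord (set_of A) j l x).
  by rewrite val_pick_ord; apply: eq_pick_nat => u lt_u; rewrite set_ofK.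
apply/allP/forallP => [all_i i|all_i i _].
  by have := all_i i (mem_enum _ _); rewrite adE.
by rewrite adE; apply: all_i.
Qed.

Lemma decodes_enc w A A' : decodes n k M0 (enc w) A A' ->
  set_of A' = searchI (set_of A) w.
Proof.
elim: w A => [|o w IHw] A dec.
  case: {-1}_ _ _ / dec (erefl (enc [::])) => // W A0 A1 le_B _ W1.
  by rewrite -W1 leqNgt B_gt1 in le_B.
have le_enc : B <= enc (o :: w).
  case: o {dec} => -[[j l] x] b /=; apply: leq_trans (leq_addl _ _).
  rewrite leq_pmull // addn_gt0 muln_gt0 addn_gt0 muln_gt0 (ltnW B_gt1) !andbT.
  by rewrite enc_digits_gt0 ?enc_gt0 // !orbT.
have [A2 opE A2E] := op_nat_enc o w A.
have -> : searchI (set_of A) (o :: w) = searchI (keepI (set_of A) o) w by [].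
rewrite -A2E; apply: IHw.
move: dec opE le_enc; move: (enc (o :: w)) => W dec.
by case: W A A' / dec {A2E} => [W A lt_B _|W A A' _ dec opE _]; [rewrite leqNgt lt_B
  | rewrite opE in dec].
Qed.

Lemma enc_digits_lt b W ii R : W < R -> enc_digits b W ii < R * B ^ size ii.
Proof.
move=> lt_W; elim: ii => [|i ii IHi] /=; first by rewrite muln1.
have := bool_B (b i); rewrite expnS mulnCA; set P := R * _ in IHi *; nia.
Qed.

(** An operation takes [k + 3] digits, namely [j], [l], [x] and [k] answers; the end marker accounts
    for the factor 2. *)
Lemma enc_lt w : enc w < 2 * B ^ ((k + 3) * size w).
Proof.
elim: w => [|[[[j l] x] b] w IHw]; first by rewrite muln0.
have digit_lt d r R : d < B -> r < R -> d + r * B < R * B by move=> *; nia.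
have -> : 2 * B ^ ((k + 3) * size ((j, l, x, b) :: w))
    = 2 * B ^ ((k + 3) * size w) * B ^ size (enum 'I_k) * B * B * B.
  rewrite size_enum_ord [size _]/= mulnS expnD [B ^ (k + 3)]expnD.
  by move: (B ^ k) (B ^ (_ * _)) => P Q; rewrite !expnS expn0 muln1; lia.
apply: (digit_lt j); first exact: ord_B.
apply: (digit_lt l); first exact: ord_B.
by apply: (digit_lt x); [exact: bool_B | exact: enc_digits_lt].
Qed.

(** Put [c = k + 3]. The base is at most [2 ^ c] and the length at most [3 * c ^ 3], so the exponent
    of 2 is at most [1 + 3 * c ^ 5], which is below [27 * c ^ 5], hence at most [c ^ 8] since [c] is
    at least 3. *)
Lemma enc_budget w : size w <= k ^ 2 * (2 * k + 4) + k -> enc w < budget k.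
Proof.
move=> le_w; apply: leq_trans (enc_lt w) _.
set c := k + 3; set E := c * size w.
have le_B : B <= 2 ^ c by apply: ltnW; apply: leq_ltn_trans (ltn_expl c _); rewrite
  // leq_add2l.
have [c_gt0 c3] : 0 < c /\ 3 <= c by rewrite /c; lia.
apply: leq_trans (_ : 2 ^ (1 + c * E) <= _).
  rewrite expnD expn1 leq_mul2l /= expnM; case: E => // E; by rewrite leq_exp2r.
rewrite leq_exp2l //.
have le_w3 : size w <= 3 * c ^ 3.
  apply: leq_trans le_w _; have -> : c ^ 3 = c ^ 2 * c by rewrite -expnSr.
  have : k ^ 2 * (2 * k + 4) <= c ^ 2 * (2 * c) by rewrite leq_mul ?leq_exp2r // /c;
    lia.
  have : k <= c ^ 2 * c by rewrite /c -mulnn; nia.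
  by lia.
have le_E : c * E <= 3 * c ^ 5.
  rewrite /E mulnA mulnn; apply: leq_trans (leq_mul (leqnn _) le_w3) _.
  by rewrite mulnCA -expnD.
have c5 : 0 < c ^ 5 by rewrite expn_gt0 c_gt0.
have : 27 * c ^ 5 <= c ^ 8.
  by rewrite -[8]/(3 + 5) expnD leq_mul2r -[27]/(3 ^ 3) leq_exp2r // c3 orbT.
by rewrite -/c; lia.
Qed.

(** * Independent sets and the answer of the program *)

Lemma success_set A : success n k M0 A -> independent e (set_of A) /\ #|set_of A| = k.
Proof.
case/andP=> /eqP cntA /allP indA; split; last by rewrite -cntA count_upto_card.
apply/forallP=> u; apply/implyP=> u_A; apply/forallP=> v; apply/implyP=> v_A.
rewrite !inE in u_A v_A; rewrite -adE.
have in_upto (w : 'I_n) : val w \in upto n by rewrite uptoE mem_iota ltn_ord.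
have := indA _ (in_upto u); rewrite u_A => /allP/(_ _ (in_upto v)).
by rewrite v_A.
Qed.

Lemma set_success A : independent e (set_of A) -> #|set_of A| = k -> success n k M0 A.
Proof.
move=> ind cardA; rewrite /success count_upto_card -/(set_of A) cardA eqxx /=.
apply/allP=> u; rewrite uptoE mem_iota => /= lt_u; apply/implyP=> u_A.
apply/allP=> v; rewrite mem_iota => /= lt_v; apply/implyP=> v_A.
have /forallP/(_ (Ordinal lt_u)) := ind; rewrite inE u_A => /forallP/(_ (Ordinal lt_v)).
by rewrite inE v_A -adE.
Qed.

(** Distinct vertices of [S] lie in distinct cliques, so [k] of them meet every clique. *)
Lemma independent_transversal (S : {set 'I_n}) : independent e S -> k <= #|S| ->
  exists y, indep_transversal e X [set: 'I_n] y.
Proof.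
move=> indS le_k.
have ind u v : u \in S -> v \in S -> ~~ e u v.
  by move=> uS vS; move/forallP/(_ u): indS; rewrite uS => /forallP/(_ v); rewrite vS.
pose c v := xchoose (X_cover v); have cP v : v \in X (c v) := xchooseP (X_cover v).
have c_inj : {in S &, injective c}.
  move=> u v uS vS eq_c; apply/eqP; apply: contraNT (ind u v uS vS).
  by apply: (X_clique (i := c u)) => //; rewrite eq_c.
have /eqP full : c @: S == setT.
  by rewrite eqEcard subsetT cardsT card_ord card_in_imset.
have ex i : exists v, (v \in S) && (v \in X i).
  by have := in_setT i; rewrite -full => /imsetP[v vS ->]; exists v; rewrite vS cP.
exists (fun i => xchoose (ex i)); split=> [i|i j].
  by rewrite in_setT; case/andP: (xchooseP (ex i)).
by case/andP: (xchooseP (ex i)) => ? _; case/andP: (xchooseP (ex j)) => ? _; apply: ind.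
Qed.

Lemma alpha_attained : exists2 S : {set 'I_n}, independent e S & #|S| = alpha e.
Proof.
have [|S indS alphaE] := @eq_bigmax_cond _ (fun S => independent e S) (fun S : {set
  'I_n} => #|S|).
  by apply/card_gt0P; exists set0; apply/forallP=> u; rewrite inE.
by exists S.
Qed.

(** When all words fail, an independent set of size at least [k] is impossible: it would yield a
    transversal, and [search_complete] a word within the budget whose survivors pass the test. *)
Lemma solutionP out :
  (exists2 A, success n k M0 A & out = 1 :: filter A (upto n)) \/
  (out = [:: 0] /\ forall W, W < budget k ->
     exists2 A, decodes n k M0 W predT A & ~~ success n k M0 A) ->
  tisehf_solution I out.
Proof.
rewrite /tisehf_solution -/k -/n -/e; case=> [[A succA outE]|[-> none]].
  have [indA cardA] := success_set succA.
  have -> : k <= alpha e.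
    by rewrite -[k]cardA; apply: (@leq_bigmax_cond _ (independent e) (fun S => #|S|)).
  exists (enum (set_of A)); split.
  - exact: enum_uniq.
  - by rewrite -cardE cardA.
  - by congr (independent e _): indA; apply/setP=> v; rewrite inE mem_enum.
  - rewrite outE; congr (_ :: _); rewrite uptoE -val_enum_ord filter_map /=; congr map.
    by rewrite enumT [RHS]/(enum_mem _); apply: eq_filter => v; rewrite /= inE.
case: ifP => // le_k; have [S indS cardS] := alpha_attained.
rewrite -cardS in le_k; have [y ty] := independent_transversal indS le_k.
have [w [le_w indw cardw]] := search_complete (@adj_sym I) (@adj_irr I) (@adj_ehf I)
  X_clique X_disj pick_ordP X_cover ty.
have [A decA /negP[]] := none _ (enc_budget le_w).
have setT_of : set_of predT = [set: 'I_n] by apply/setP=> v; rewrite !inE.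
by apply: set_success; rewrite (decodes_enc decA) setT_of.
Qed.

End Instance.

Theorem theorem2 : FPT TISEHF.
Proof.
exists (code 0 MAIN), (fun k => (budget k + k + 3) ^ 4), 3, 500 => I.
set n := nvert I; set k := nclq I; set M0 := nth 0 (tisehf_encoding I).
have [s' [t [run_t le_t post]]] := @main_ok n k M0 (fun=> 0, M0) (fun=> erefl) erefl
  erefl erefl.
exists t, (mkseq s'.2 (s'.1 0)); split.
- exact: code_runs run_t isT.
- exact: solutionP post.
- by move=> n_gt0; apply: leq_trans le_t (main_time_le _ n_gt0).
Qed.
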